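(* Let $H$ be an infinite-dimensional complex Hilbert space, let $k$ be a natural number, and let $\mathcal{G}_k(H)$ be the set of all $k$-dimensional subspaces of $H$. Let $f$ be a bijective transformation of $\mathcal{G}_k(H)$ such that both $f$ and $f^{-1}$ send orthogonal apartments of $\mathcal{G}_k(H)$ to orthogonal apartments of $\mathcal{G}_k(H)$; equivalently, $f$ preserves the compatibility relation in both directions (i.e. for all $X,Y\in\mathcal{G}_k(H)$, $X$ and $Y$ are compatible if and only if $f(X)$ and $f(Y)$ are compatible). Then $f$ can be uniquely extended to an automorphism of the logic $\mathcal{L}(H)$.
   Context: $\mathcal{L}(H)$ denotes the logic (orthomodular lattice) of all closed subspaces of $H$, ordered by inclusion and equipped with orthogonal complementation; an automorphism of $\mathcal{L}(H)$ is a bijection of $\mathcal{L}(H)$ preserving inclusion in both directions and commuting with orthogonal complementation, and ''extends $f$'' means it agrees with $f$ on $\mathcal{G}_k(H)\subset\mathcal{L}(H)$. An orthogonal apartment of $\mathcal{G}_k(H)$ is, for some orthogonal base $\{e_i\}_{i\in I}$ of $H$, the set of all $k$-dimensional subspaces spanned by subsets of $\{e_i\}_{i\in I}$. Two closed subspaces $X,Y\subset H$ are compatible if there exist closed subspaces $X',Y'$ such that $X\cap Y$, $X'$, $Y'$ are mutually orthogonal and $X=X'+(X\cap Y)$, $Y=Y'+(X\cap Y)$. *)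

(* Defs.v *)
From HB Require Import structures.
From mathcomp Require Import all_boot all_order all_algebra.
From mathcomp Require Import complex.
From mathcomp Require Import boolp classical_sets functions reals topology normedtype.

Set Implicit Arguments.
Unset Strict Implicit.
Unset Printing Implicit Defensive.

Import Order.TTheory GRing.Theory Num.Theory.
Import numFieldNormedType.Exports.

Local Open Scope classical_set_scope.
Local Open Scope complex_scope.
Local Open Scope ring_scope.

Definition lspan (R : realType) (H : normedModType R[i]) (B : set H) : set H :=
  smallest (fun V : set H => submod_closed [in V]) B.

Definition has_dim (R : realType) (H : normedModType R[i]) (n : nat)
    (X : set H) : Prop :=
  exists e : 'I_n -> H,
    (forall c : 'I_n -> R[i], \sum_(i < n) c i *: e i = 0 -> forall i, c i = 0)
    /\ X = lspan (range e).

Definition infinite_dimensional (R : realType) (H : normedModType R[i]) : Prop :=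
  forall n : nat, ~ has_dim n [set: H].

Record closed_subspace (R : realType) (H : normedModType R[i]) :=
  ClosedSubspace {
    cs_set :> set H;
    cs_submod : submod_closed [in cs_set];
    cs_closed : closed cs_set }.

(* A finite-dimensional subspace is automatically closed, so the type below has
   all n-dimensional linear subspaces as elements. *)
Record grassmannian (R : realType) (H : normedModType R[i]) (n : nat) :=
  Grassmannian {
    gr_cs :> closed_subspace H;
    gr_dim : has_dim n gr_cs }.

(* The norm of H : normedModType R[i] takes values in R[i]. Together with
   H : completeNormedModType R[i], this says that (H, dot) is a complex Hilbert
   space, with dot linear in its first argument and conjugate-linear in its
   second one. *)
Definition induces_norm (R : realType) (H : normedModType R[i])
    (dot : {dot H for Num.conj}) : Prop :=
  forall x : H, `|x| ^+ 2 = dot x x.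

Section Orthogonality.
Context (R : realType) (H : normedModType R[i]) (dot : {dot H for Num.conj}).

Definition orthogonal_sets (X Y : set H) : Prop :=
  forall x y, X x -> Y y -> dot x y = 0.

Definition orthocompl_set (X : set H) : set H :=
  [set x | forall y, X y -> dot x y = 0].

Lemma orthocompl_submod (X : set H) : submod_closed [in orthocompl_set X].
Proof.
split; first by rewrite inE => y _; rewrite linear0l.
move=> a u v; rewrite !inE => hu hv y Xy.
by rewrite linearPl /= hu// hv// mulr0 addr0.
Qed.

Lemma dot_cauchy_schwarz (u v : H) : `|dot u v| ^+ 2 <= dot u u * dot v v.
Proof.
have [->|v0] := eqVneq v 0; first by rewrite !linear0r normr0 expr0n mulr0.
have vv : 0 < dot v v by rewrite dnorm_gt0.
pose a := dot u v / dot v v; pose w := u - a *: v.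
have wv : dot w v = 0.
  by rewrite linearBl/= linearZl_LR /= divfK ?subrr// gt_eqF.
have -> : dot u u = dot w w + `|a| ^+ 2 * dot v v.
  rewrite -dnormZ -[u in LHS](subrK (a *: v)) -/w hnormDd//.
  by rewrite linearZr_LR /= wv mulr0.
rewrite mulrDl -mulrA -expr2 -[dot v v in X in _ + X](gtr0_norm vv).
by rewrite -exprMn -normrM divfK ?gt_eqF// lerDr mulr_ge0// ltW.
Qed.

Lemma orthocompl_closed (dotn : induces_norm dot) (X : set H) :
  closed (orthocompl_set X).
Proof.
move=> x clx y Xy; apply/eqP; apply: contraT => c0.
have y0 : 0 < `|y|.
  by rewrite normr_gt0; apply: contraNneq c0 => ->; rewrite linear0r.
have e0 : 0 < `|dot x y| / `|y| by rewrite divr_gt0 // normr_gt0.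
have [z [hz]] := clx _ (nbhsx_ballx x _ e0).
rewrite -ball_normE /= ltr_pdivlMr// => xz.
have : `|dot x y| <= `|x - z| * `|y|.
  rewrite -(@ler_pXn2r _ 2) ?nnegrE ?mulr_ge0// exprMn !dotn.
  apply: le_trans (dot_cauchy_schwarz _ _).
  by rewrite linearBl /= (hz _ Xy) subr0.
by move=> /(lt_le_trans xz); rewrite ltxx.
Qed.

Definition orthocompl (dotn : induces_norm dot) (X : closed_subspace H) :
    closed_subspace H :=
  ClosedSubspace (orthocompl_submod X) (orthocompl_closed dotn (X:=X)).

(* An orthogonal base {e_i} is represented by its set of vectors; density of the
   span, rather than equality with H, is the Hilbert-space notion of base. *)
Definition orthogonal_base (B : set H) : Prop :=
  [/\ ~ B 0,
      forall x y, B x -> B y -> x <> y -> dot x y = 0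
    & closure (lspan B) = [set: H]].

Definition orthogonal_apartment (k : nat) (A : set (grassmannian H k)) : Prop :=
  exists2 B : set H, orthogonal_base B &
    A = [set X : grassmannian H k |
          exists2 S : set H, S `<=` B & (X : set H) = lspan S].

Definition sum_set (X Y : set H) : set H := [set x + y | x in X & y in Y].

Definition compatible (X Y : closed_subspace H) : Prop :=
  exists X' Y' : closed_subspace H,
    [/\ orthogonal_sets (X `&` Y) X',
        orthogonal_sets (X `&` Y) Y',
        orthogonal_sets X' Y',
        X = sum_set X' (X `&` Y) :> set H
      & Y = sum_set Y' (X `&` Y) :> set H].

(* For bijective f, the preimage f @^-1` A is the image of A under the inverse
   of f. *)
Definition preserves_apartments (k : nat)
    (f : grassmannian H k -> grassmannian H k) : Prop :=
  (forall A, orthogonal_apartment A -> orthogonal_apartment (f @` A)) /\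
  (forall A, orthogonal_apartment A -> orthogonal_apartment (f @^-1` A)).

Definition preserves_compatibility (k : nat)
    (f : grassmannian H k -> grassmannian H k) : Prop :=
  forall X Y : grassmannian H k, compatible X Y <-> compatible (f X) (f Y).

Definition logic_automorphism (dotn : induces_norm dot)
    (g : closed_subspace H -> closed_subspace H) : Prop :=
  [/\ bijective g,
      forall X Y : closed_subspace H, X `<=` Y <-> g X `<=` g Y
    & forall X, g (orthocompl dotn X) = orthocompl dotn (g X)].

End Orthogonality.

(* Main.v *)
(* Compatibility of two subspaces means that their projections commute. By Zorn's
   lemma a family of pairwise compatible finite-dimensional subspaces is adapted
   to a common orthogonal base, so orthogonal apartments are the maximal sets of
   mutually compatible elements of G_k(H), and the two conditions on f agree.

   Call the trace of T on an apartment the set of its elements compatible with T.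
   The maximal traces of elements T outside the apartment of a base B are the
   sets of elements which do not separate b from b', for b <> b' in B. Hence X
   and Y in the apartment are orthogonal iff only finitely many maximal traces
   avoid both of them, and f preserves orthogonality in both directions.

   For x <> 0, the vectors orthogonal to f(T) for all T in G_k(H) orthogonal to x
   form a line. This gives an orthogonality preserving bijection of the lines,
   which extends to closed subspaces because M is its own second orthogonal
   complement. Uniqueness holds since a line is the intersection of the
   k-dimensional subspaces containing it. *)

Require Import Defs.
From HB Require Import structures.
From mathcomp Require Import all_boot all_order all_algebra.
From mathcomp Require Import complex ring lra.
From mathcomp Require Import boolp classical_sets functions cardinality reals.
From mathcomp Require Import topology normedtype.

Import Order.TTheory GRing.Theory Num.Theory.
Import numFieldNormedType.Exports.

Local Open Scope classical_set_scope.
Local Open Scope complex_scope.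
Local Open Scope ring_scope.

Set Implicit Arguments.
Unset Strict Implicit.
Unset Printing Implicit Defensive.

Identity Coercion fun_of_set : set >-> Funclass.

(** * Orthogonal projections *)

Section InnerProduct.
Context (R : realType) (H : normedModType R[i]) (dot : {dot H for Num.conj}).
Implicit Types (x y z : H) (c : R[i]) (V W : set H).

Lemma dotDl x y z : dot (x + y) z = dot x z + dot y z.
Proof. by rewrite linearDl. Qed.

Lemma dotBl x y z : dot (x - y) z = dot x z - dot y z.
Proof. by rewrite linearBl. Qed.

Lemma dotZl c x y : dot (c *: x) y = c * dot x y.
Proof. by rewrite linearZl_LR. Qed.

Lemma dotDr x y z : dot x (y + z) = dot x y + dot x z.
Proof. by rewrite linearDr. Qed.

Lemma dotBr x y z : dot x (y - z) = dot x y - dot x z.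
Proof. by rewrite linearBr. Qed.

Lemma dotZr c x y : dot x (c *: y) = c^* * dot x y.
Proof. by rewrite linearZr_LR. Qed.

Lemma dot0l x : dot 0 x = 0.
Proof. by rewrite linear0l. Qed.

Lemma dot0r x : dot x 0 = 0.
Proof. by rewrite linear0r. Qed.

Lemma dot_sym0 x y : dot x y = 0 -> dot y x = 0.
Proof. by move/eqP; rewrite herm_eq0C => /eqP. Qed.

Lemma dot_eq0 x : dot x x = 0 -> x = 0.
Proof. by move/eqP; rewrite dnorm_eq0 => /eqP. Qed.

Lemma dot_neq0 x : x != 0 -> dot x x != 0.
Proof. by rewrite dnorm_eq0. Qed.

(** The squared norm as an element of [R], where infima exist and [lra] applies; [dot] itself takes
    values in [R[i]]. *)
Definition sqn x : R := complex.Re (dot x x).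

Lemma sqnE x : dot x x = (sqn x)%:C.
Proof.
have := dnorm_ge0 dot x; rewrite /sqn lecE => /andP[/eqP/= + _].
by case: (dot x x) => a b /= ->.
Qed.

Lemma sqn_ge0 x : 0 <= sqn x.
Proof. by rewrite -lecR -sqnE dnorm_ge0. Qed.

Lemma parallelogram x y : sqn (x - y) + sqn (x + y) = (sqn x + sqn y) *+ 2.
Proof.
apply: complexI; rewrite raddfD/= raddfMn/= raddfD/= -!sqnE.
by rewrite !(dotBl, dotBr, dotDl, dotDr); ring.
Qed.

Lemma sqn_proj u v : let a := dot u v / dot v v in
  dot u u = dot (u - a *: v) (u - a *: v) + `|a| ^+ 2 * dot v v.
Proof.
move=> a; have [->|v0] := eqVneq v 0.
  by rewrite scaler0 subr0 dot0r mulr0 addr0.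
have ua : dot (u - a *: v) (a *: v) = 0.
  by rewrite dotZr dotBl dotZl divfK ?dot_neq0// subrr mulr0.
by rewrite -dnormZ -[u in LHS](subrK (a *: v)) hnormDd.
Qed.

(** A quantitative form of the fact that a distance minimizer leaves an orthogonal remainder: for
    nonzero [v], removing from [u] its component along [v] lowers [sqn u] by
    [|dot u v|^2 / dot v v], but never below [d]. *)
Lemma near_min_dot (d e : R) u v : (forall c, d <= sqn (u - c *: v)) ->
  sqn u < d + e -> `|dot u v| ^+ 2 <= e%:C * dot v v.
Proof.
move=> dmin ue; have [->|v0] := eqVneq v 0.
  by rewrite !dot0r normr0 expr0n mulr0.
have vv : 0 < dot v v by rewrite dnorm_gt0.
have := sqn_proj u v => /=; set a := _ / _ => uE.
rewrite -[dot u v](@divfK _ (dot v v)) ?dot_neq0// -/a normrM exprMn expr2.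
rewrite (gtr0_norm vv) mulrA ler_pM2r//.
rewrite -(lerD2l (dot (u - a *: v) (u - a *: v))) -uE.
rewrite !sqnE -raddfD/= lecR ltW// (lt_le_trans ue)// lerD2r; exact: dmin.
Qed.

Section Norm.
Hypothesis dotn : induces_norm dot.

Lemma normE_lt x (e : R[i]) : 0 < e -> (`|x| < e) = (sqn x < complex.Re e ^+ 2).
Proof.
move=> e0; have eE : e = (complex.Re e)%:C.
  by move: e0; rewrite ltcE => /andP[/eqP/= + _]; case: e => a b /= ->.
rewrite -(@ltr_pXn2r _ 2) ?nnegrE ?normr_ge0 ?(ltW e0)// dotn sqnE.
by rewrite [in LHS]eE -ltcR rmorphXn.
Qed.

Lemma dot_le x y : `|dot x y| <= `|x| * `|y|.
Proof.
rewrite -(@ler_pXn2r _ 2) ?nnegrE ?mulr_ge0// exprMn !dotn.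
exact: dot_cauchy_schwarz.
Qed.

End Norm.

End InnerProduct.

Section Projection.
Context (R : realType) (H : completeNormedModType R[i]).
Context (dot : {dot H for Num.conj}) (dotn : induces_norm dot).
Implicit Types (x y z : H) (c : R[i]) (V W : set H).

Definition perp V x : Prop := forall y, V y -> dot x y = 0.

Lemma submod0 V : submod_closed [in V] -> V 0.
Proof. by case; rewrite inE. Qed.

Lemma submodL V a x y : submod_closed [in V] -> V x -> V y -> V (a *: x + y).
Proof. by case=> _ + Vx Vy; move=> /(_ a x y); rewrite !inE; apply. Qed.

Lemma submodZ V a x : submod_closed [in V] -> V x -> V (a *: x).
Proof.
by move=> sV Vx; rewrite -[_ *: _]addr0; apply: submodL => //; apply: submod0.
Qed.

Lemma submodD V x y : submod_closed [in V] -> V x -> V y -> V (x + y).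
Proof. by move=> sV Vx Vy; rewrite -[x]scale1r; apply: submodL. Qed.

Lemma submodB V x y : submod_closed [in V] -> V x -> V y -> V (x - y).
Proof.
by move=> sV Vx Vy; rewrite addrC -scaleN1r; apply: submodL.
Qed.

(* By the parallelogram law the near-minimizers of the distance from [z] to [V]
   form a Cauchy filter. *)
Lemma closure_proj V z : submod_closed [in V] ->
  exists2 p, closure V p & perp V (z - p).
Proof.
move=> sV; pose E := [set sqn dot (z - m) | m in V].
have Einf : has_inf E.
  split; first by exists (sqn dot (z - 0)); exists 0 => //; apply: submod0.
  by exists 0 => _ [m _ <-]; apply: sqn_ge0.
pose d := inf E.
have dmin m : V m -> d <= sqn dot (z - m).
  by move=> Vm; apply: ge_inf; [case: Einf|exists m].
pose S (e : R) := [set m | V m /\ sqn dot (z - m) < d + e].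
pose F := filter_from [set e : R | 0 < e] S.
have Sclose (e : R) m m' : S e m -> S e m' -> sqn dot (m - m') < 4 * e.
  move=> [Vm me] [Vm' me'].
  (* The sum of the two vectors is twice the vector from the midpoint of [m] and [m'] to [z]; this
     midpoint lies in [V], so [d] bounds its squared distance from below. *)
  have := parallelogram dot (z - m') (z - m).
  have -> : z - m' - (z - m) = m - m' by rewrite opprB addrC addrA subrK.
  have -> : z - m' + (z - m) = 2%:R *: (z - 2%:R^-1 *: (m + m')).
    rewrite scalerBr scalerA divff ?pnatr_eq0// scale1r scaler_nat mulr2n.
    by rewrite addrACA -opprD [m' + m]addrC.
  have -> : sqn dot (2%:R *: (z - 2%:R^-1 *: (m + m'))) =
            4 * sqn dot (z - 2%:R^-1 *: (m + m')).
    apply: complexI; rewrite -sqnE dotZl dotZr.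
    rewrite rmorph_nat rmorphM rmorph_nat /= -sqnE mulrA -natrM; congr (_ * _).
  have : d <= sqn dot (z - 2%:R^-1 *: (m + m')).
    by apply: dmin; apply: submodZ => //; apply: submodD.
  by move=> h1 h2; move: me me' h1 h2; rewrite mulr2n => me me' h1 h2; lra.
have FF : ProperFilter F.
  apply: filter_from_proper.
    apply: filter_from_filter; first by exists 1; rewrite /= ltr01.
    move=> e e' /= e0 e'0; exists (Num.min e e') => /=.
      by rewrite lt_min e0.
    move=> m [Vm]; rewrite /= => me; split; split=> //; apply: lt_le_trans me _;
      by rewrite lerD2l ge_min lexx ?orbT.
  move=> e /= e0; have [_ [m Vm <-] me] := inf_adherent e0 Einf.
  by exists m.
have /cauchy_cvg : cauchy F.
  apply/cauchyP => e e0.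
  have e0' : 0 < complex.Re e by move: e0; rewrite ltcE => /andP[].
  pose h := complex.Re e ^+ 2 / 4.
  have h0 : 0 < h by rewrite divr_gt0// exprn_gt0.
  have [_ [m Vm <-] me] := inf_adherent h0 Einf.
  exists m; exists h => // m' Sm'; rewrite -ball_normE /= (normE_lt dotn)//.
  rewrite (lt_le_trans (Sclose h _ _ _ Sm'))//.
  by rewrite /h mulrCA divff ?mulr1// pnatr_eq0.
move=> /cvg_ex[p Fp]; exists p.
  move=> B /Fp FB; have : F (V `&` B).
    apply: filterI => //; exists 1; first by rewrite /= ltr01.
    by move=> m [].
  by move=> /filter_ex.
move=> v Vv; apply/eqP; apply: contraT => c0.
have v0 : 0 < `|v|.
  by rewrite normr_gt0; apply: contraNneq c0 => ->; rewrite dot0r.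
(* With this third, the contributions of [z - m] and [m - p] add up to less than the full value of
   [|dot (z - p) v|]. *)
pose e := `|dot (z - p) v| / (3%:R * `|v|).
have e0 : 0 < e by rewrite divr_gt0 ?normr_gt0 ?mulr_gt0.
have eE : e = (complex.Re e)%:C.
  by move: e0; rewrite ltcE => /andP[/eqP/= + _]; case: (e) => a b /= ->.
have h0 : 0 < complex.Re e ^+ 2.
  by rewrite exprn_gt0//; move: e0; rewrite ltcE => /andP[].
have : F (S (complex.Re e ^+ 2) `&` ball p e).
  apply: filterI; first by exists (complex.Re e ^+ 2).
  by apply: Fp; apply: nbhsx_ballx.
move=> /filter_ex[m [[Vm zm]]]; rewrite -ball_normE /= => pm.
have zmv : `|dot (z - m) v| <= e * `|v|.
  have ev0 : 0 <= e * `|v| by rewrite mulr_ge0// ltW.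
  rewrite -(@ler_pXn2r _ 2) ?nnegrE ?normr_ge0// exprMn dotn.
  have -> : e ^+ 2 = (complex.Re e ^+ 2)%:C by rewrite {1}eE rmorphXn.
  apply: (near_min_dot (d := d)) => // c.
  by rewrite -addrA -opprD; apply: dmin; apply: submodD => //; apply: submodZ.
have pmv : `|dot (m - p) v| < e * `|v|.
  apply: (le_lt_trans (dot_le dotn _ _)); rewrite ltr_pM2r//.
  by rewrite distrC.
have : `|dot (z - p) v| < e * `|v| + e * `|v|.
  rewrite -(subrK m z) -addrA dotDl (le_lt_trans (ler_normD _ _))//.
  exact: ler_ltD.
have -> : e * `|v| = `|dot (z - p) v| / 3%:R.
  by rewrite /e invfM -!mulrA mulVf ?mulr1// gt_eqF.
rewrite -mulrDr -subr_gt0 -{2}[`|dot _ _|]mulr1 -mulrBr pmulr_rgt0 ?normr_gt0//.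
move=> h; have : (3%:R^-1 + 3%:R^-1 - 1 : R[i]) < 0.
  have -> : (3%:R^-1 + 3%:R^-1 - 1 : R[i]) = - 3%:R^-1 by field.
  by rewrite oppr_lt0 invr_gt0.
by move=> /(lt_trans h); rewrite ltxx.
Qed.

End Projection.

(** * The lattice of closed subspaces *)

Section ClosedSubspaces.
Context (R : realType) (H : completeNormedModType R[i]).
Context (dot : {dot H for Num.conj}) (dotn : induces_norm dot).
Implicit Types (a b x y z : H) (c : R[i]) (V W : set H).
Implicit Types (M N S : closed_subspace H).
Local Notation perp := (perp dot).

Lemma cs_inj M N : M = N :> set H -> M = N.
Proof.
case: M N => [V sV cV] [W sW cW] /= E; case: _ / E in sW cW *.
by rewrite (Prop_irrelevance sV sW) (Prop_irrelevance cV cW).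
Qed.

Lemma csP M N : (forall x, M x <-> N x) -> M = N.
Proof. by move=> MN; apply/cs_inj/seteqP; split=> x /MN. Qed.

Lemma cs_zero M : M 0. Proof. exact: submod0 (cs_submod M). Qed.

Lemma csZ M c x : M x -> M (c *: x). Proof. exact: submodZ (cs_submod M). Qed.

Lemma csD M x y : M x -> M y -> M (x + y).
Proof. exact: submodD (cs_submod M). Qed.

Lemma csB M x y : M x -> M y -> M (x - y).
Proof. exact: submodB (cs_submod M). Qed.

Lemma perpS V W x : V `<=` W -> perp W x -> perp V x.
Proof. by move=> VW Wx y /VW/Wx. Qed.

Lemma perpZ V c x : perp V x -> perp V (c *: x).
Proof. by move=> Vx y Vy; rewrite dotZl Vx// mulr0. Qed.

Lemma perpD V x y : perp V x -> perp V y -> perp V (x + y).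
Proof. by move=> Vx Vy z Vz; rewrite dotDl Vx// Vy// addr0. Qed.

Lemma perpB V x y : perp V x -> perp V y -> perp V (x - y).
Proof. by move=> Vx Vy z Vz; rewrite dotBl Vx// Vy// subr0. Qed.

Lemma perp_id V x : V x -> perp V x -> x = 0.
Proof. by move=> Vx /(_ x Vx) /dot_eq0. Qed.

Lemma cs_proj M z : exists2 p, M p & perp M (z - p).
Proof.
have [p pM pz] := closure_proj dotn z (cs_submod M); exists p => //.
exact: cs_closed.
Qed.

Definition proj M z : H := s2val (cid2 (cs_proj M z)).

Lemma projM M z : M (proj M z).
Proof. by rewrite /proj; case: cid2. Qed.

Lemma proj_perp M z : perp M (z - proj M z).
Proof. by rewrite /proj; case: cid2. Qed.

Lemma proj_uniq M z p : M p -> perp M (z - p) -> proj M z = p.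
Proof.
move=> Mp zp; apply/eqP; rewrite -subr_eq0; apply/eqP.
apply: (@perp_id M); first by apply: csB => //; apply: projM.
have -> : proj M z - p = (z - p) - (z - proj M z).
  by rewrite opprB [RHS]addrC addrA subrK.
by apply: perpB => //; apply: proj_perp.
Qed.

Lemma proj_id M z : M z -> proj M z = z.
Proof.
by move=> Mz; apply: proj_uniq => //; rewrite subrr => y _; rewrite dot0l.
Qed.

Lemma proj_eq0 M z : perp M z -> proj M z = 0.
Proof. by move=> Mz; apply: proj_uniq; rewrite ?subr0//; apply: cs_zero. Qed.

Lemma projD M x y : proj M (x + y) = proj M x + proj M y.
Proof.
apply: proj_uniq; first by apply: csD; apply: projM.
by rewrite opprD addrACA; apply: perpD; apply: proj_perp.
Qed.

Lemma projZ M c x : proj M (c *: x) = c *: proj M x.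
Proof.
apply: proj_uniq; first by apply: csZ; apply: projM.
by rewrite -scalerBr; apply: perpZ; apply: proj_perp.
Qed.

Lemma projB M x y : proj M (x - y) = proj M x - proj M y.
Proof. by rewrite -scaleN1r projD projZ scaleN1r. Qed.

Lemma dot_proj M x y : dot (proj M x) y = dot x (proj M y).
Proof.
have h u v : dot (proj M u) v = dot (proj M u) (proj M v).
  apply/eqP; rewrite -subr_eq0 -dotBr; apply/eqP/dot_sym0.
  exact/proj_perp/projM.
rewrite h; apply/esym/eqP; rewrite -subr_eq0 -dotBl; apply/eqP.
exact/proj_perp/projM.
Qed.

Lemma biperp M x : (forall y, perp M y -> dot x y = 0) -> M x.
Proof.
move=> Mx; rewrite -[x](subrK (proj M x)).
suff -> : x - proj M x = 0 by rewrite add0r; exact: projM.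
apply: (dot_eq0 (dot := dot)); rewrite dotBl; have px := @proj_perp M x.
by rewrite (Mx _ px) (dot_sym0 (px _ (projM _ _))) subrr.
Qed.

Definition cs_perp V : closed_subspace H :=
  ClosedSubspace (orthocompl_submod dot V) (orthocompl_closed dotn (X := V)).

Definition cs0 : closed_subspace H := cs_perp setT.

Lemma cs0E x : cs0 x <-> x = 0.
Proof.
by split=> [h|-> y _]; [apply: (dot_eq0 (dot := dot)); apply: h|rewrite dot0l].
Qed.

(** The double complement makes closedness automatic; [addvE] shows that it adds nothing to the
    algebraic sum. *)
Definition addv M a : closed_subspace H :=
  cs_perp (cs_perp [set m + c *: a | m in M & c in [set: R[i]]]).

(** The candidate [p] is the projection of [x] to the sum, computed through the part [a'] of [a]
    orthogonal to [M]. The remainder [x - p] is in the first complement, so it is orthogonal to [x]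
    as well as to [p], hence zero. *)
Lemma addvE M a x : addv M a x <-> exists m c, M m /\ x = m + c *: a.
Proof.
split=> [h|[m [c [Mm ->]]] y hy]; last first.
  by apply: dot_sym0; apply: hy; exists m => //; exists c.
pose a' := a - proj M a; pose c := dot x a' / dot a' a'.
have a'M : perp M a' by apply: proj_perp.
have Ma' m : M m -> dot m a' = 0 by move=> /a'M/dot_sym0.
pose p := proj M x + c *: a'.
have xp : perp M (x - p).
  by rewrite opprD addrA; apply: perpB; [apply: proj_perp|apply: perpZ].
have xpa : dot (x - p) a' = 0.
  rewrite dotBl dotDl dotZl (Ma' _ (projM _ _)) add0r.
  have [->|a0] := eqVneq a' 0; first by rewrite !dot0r mulr0 subrr.
  by rewrite divfK ?dot_neq0// subrr.
have yxp : x - p = 0.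
  apply: (dot_eq0 (dot := dot)); rewrite dotBl (h (x - p)) ?sub0r; last first.
    move=> _ [m Mm [d _ <-]]; rewrite dotDr dotZr xp// add0r.
    rewrite -[a](subrK (proj M a)) -/a' dotDr xpa xp ?addr0 ?mulr0//.
    exact: projM.
  rewrite dotDl (dot_sym0 (xp _ (projM _ _))) dotZl (dot_sym0 xpa) mulr0.
  by rewrite addr0 oppr0.
exists (proj M x - c *: proj M a), c.
split; first by apply: csB; [|apply: csZ]; apply: projM.
by move/subr0_eq: yxp => {1}->; rewrite /p scalerBr addrA addrAC.
Qed.

Lemma addv_sub M a : M `<=` addv M a.
Proof. by move=> x Mx; apply/addvE; exists x, 0; rewrite scale0r addr0. Qed.

Lemma addv_mem M a : addv M a a.
Proof.
by apply/addvE; exists 0, 1; rewrite scale1r add0r; split=> //; apply: cs_zero.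
Qed.

Lemma addv_min M N a : M `<=` N -> N a -> addv M a `<=` N.
Proof.
by move=> MN Na _ /addvE[m [c [/MN Nm ->]]]; apply: csD => //; apply: csZ.
Qed.

Lemma perp_addv M a x : perp M x -> dot x a = 0 -> perp (addv M a) x.
Proof.
move=> Mx xa _ /addvE[m [c [Mm ->]]].
by rewrite dotDr dotZr Mx// xa mulr0 addr0.
Qed.

Definition capcs M N : closed_subspace H := cs_perp (cs_perp M `|` cs_perp N).

Lemma capcsE M N x : capcs M N x <-> M x /\ N x.
Proof.
split=> [h|[Mx Nx] y [/(_ x Mx)|/(_ x Nx)]]; try exact: dot_sym0.
by split; apply: biperp => y hy; apply: h; [left|right].
Qed.

Definition del M a : closed_subspace H := capcs M (cs_perp [set a]).

Lemma delE M a x : del M a x <-> M x /\ dot x a = 0.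
Proof.
split=> [/capcsE[Mx xa]|[Mx xa]]; first by split=> //; apply: xa.
by apply/capcsE; split=> // y ->.
Qed.

Lemma del_sub M a : del M a `<=` M.
Proof. by move=> x /delE[]. Qed.

Lemma perp_del M a : perp (del M a) a.
Proof. by move=> x /delE[_ /dot_sym0]. Qed.

Lemma addv_del M a : M a -> M = addv (del M a) a.
Proof.
move=> Ma; apply: csP => x; split=> [Mx|]; last first.
  by apply: addv_min => //; apply: del_sub.
apply/addvE; have [->|a0] := eqVneq a 0.
  by exists x, 0; rewrite scale0r addr0; split=> //; apply/delE; rewrite dot0r.
exists (x - (dot x a / dot a a) *: a), (dot x a / dot a a).
split; last by rewrite subrK.
apply/delE; split; first by apply: csB => //; apply: csZ.
by rewrite dotBl dotZl divfK ?dot_neq0// subrr.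
Qed.

(** * Dimension *)

(* Orthogonal dimension: [M] is built from 0 by adjoining [n] pairwise
   orthogonal nonzero vectors. *)
Fixpoint odim (n : nat) M : Prop :=
  if n is n'.+1 then
    exists M' a, [/\ odim n' M', a != 0, perp M' a & M = addv M' a]
  else M = cs0.

Lemma odimS n M a : odim n M -> a != 0 -> perp M a -> odim n.+1 (addv M a).
Proof. by move=> ? ? ?; exists M, a. Qed.

(** The vector [a] need not be one of those adjoined to build [M]. Written as [x + c *: b] with [x]
    nonzero, its complement in [M] consists of the complement of [x] in [M'] and the line orthogonal
    to [a] in the plane of [x] and [b]. *)
Lemma odim_del n M a : odim n.+1 M -> M a -> a != 0 -> odim n (del M a).
Proof.
elim: n M a => [|n IH] M a [M' [b [dM' b0 M'b ->]]] /addvE[x [c [M'x ->]]] xb0.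
  move: dM' => /= dM'; rewrite dM' in M'x *.
  move: M'x xb0 => /cs0E ->; rewrite add0r => cb0; apply: csP => z.
  split=> [/delE[/addvE[w [d [/cs0E -> ->]]]]|/cs0E ->]; last exact: cs_zero.
  rewrite add0r dotZl dotZr => /eqP; rewrite !mulf_eq0 conjC_eq0.
  move: cb0; rewrite scaler_eq0 negb_or => /andP[/negbTE -> _].
  rewrite (negbTE (dot_neq0 _ b0)) !orbF => /eqP ->.
  by rewrite scale0r; apply: cs_zero.
have [x0|x0] := eqVneq x 0.
  rewrite x0 add0r in xb0 *; suff -> : del (addv M' b) (c *: b) = M' by [].
  move: xb0; rewrite scaler_eq0 negb_or => /andP[c0 _].
  apply: csP => z; split=> [/delE[/addvE[w [d [M'w ->]]]]|M'z].
    rewrite dotDl !dotZr (dot_sym0 (M'b _ M'w)) mulr0 add0r dotZl => /eqP.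
    rewrite !mulf_eq0 conjC_eq0 (negbTE c0) (negbTE (dot_neq0 _ b0)) orbF/=.
    by move=> /eqP ->; rewrite scale0r addr0.
  apply/delE; split; first exact: addv_sub.
  by rewrite dotZr (dot_sym0 (M'b _ M'z)) mulr0.
(* the vector of span(x, b) orthogonal to x + c b *)
pose u := dot x x *: b - (c^* * dot b b) *: x.
have xb : dot x b = 0 by apply/dot_sym0/M'b.
have bx : dot b x = 0 by apply/M'b.
have u0 : u != 0.
  apply: contraNneq b0 => u0; have : dot u b = 0 by rewrite u0 dot0l.
  rewrite dotBl !dotZl xb mulr0 subr0 => /eqP; rewrite mulf_eq0.
  by rewrite (negbTE (dot_neq0 _ x0)) => /eqP/dot_eq0 ->.
exists (del M' x), u; split => //; first exact: IH.
  move=> y /delE[M'y yx].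
  by rewrite dotBl !dotZl (M'b _ M'y) (dot_sym0 yx) !mulr0 subrr.
have ux : dot u (x + c *: b) = 0.
  by rewrite dotDr !dotBl !dotZl !dotZr xb bx; ring.
apply: csP => z; split=> [/delE[/addvE[w [d [M'w ->]]]]|].
  rewrite dotDl !dotDr !dotZl !dotZr bx (dot_sym0 (M'b _ M'w)).
  rewrite mulr0 addr0 mulr0 add0r => wx.
  (* These coefficients come from solving the definition of [u] for [b]. *)
  apply/addvE; exists (w + (d * c^* * dot b b / dot x x) *: x), (d / dot x x).
  split.
    apply/delE; split; first by apply: csD => //; apply: csZ.
    rewrite dotDl dotZl divfK ?dot_neq0//; move: wx.
    by rewrite mulrA.
  rewrite scalerBr !scalerA divfK ?dot_neq0// -addrA; congr (_ + _).
  rewrite addrCA -scalerBl [X in X *: x](_ : _ = 0) ?scale0r ?addr0//.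
  by rewrite !mulrA; apply/eqP; rewrite subr_eq0 -!mulrA; apply/eqP; ring.
move: z; apply: addv_min => [z /delE[M'z zx]|]; apply/delE; split => //.
- exact: addv_sub.
- by rewrite dotDr dotZr zx (dot_sym0 (M'b _ M'z)) mulr0 addr0.
- apply: csB; first by apply: csZ; apply: addv_mem.
  by apply: csZ; apply: addv_sub.
Qed.

Lemma cs_nz M : (exists2 a, M a & a != 0) \/ M = cs0.
Proof.
have [h|h] := pselect (exists2 a, M a & a != 0); [by left|right].
apply: csP => x; split=> [Mx|/cs0E ->]; last exact: cs_zero.
by apply/cs0E/eqP; apply: contraPT (Mx) => x0 _; apply: h; exists x.
Qed.

(** Removing the same nonzero vector of [N] from both spaces lowers both dimensions by one. *)
Lemma odim_sub n M N : odim n M -> N `<=` M ->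
  exists m, [/\ odim m N, (m <= n)%N & m = n -> N = M].
Proof.
elim: n M N => [|n IH] M N dM NM.
  exists 0%N; have N0 : N = cs0.
    apply: csP => x; split=> [/NM|/cs0E ->]; last exact: cs_zero.
    by move: dM => /= ->.
  by split=> // _; rewrite N0 dM.
have [[a Na a0]|->] := cs_nz N; last by exists 0%N.
have [|m [dm mn mE]] := IH (del M a) (del N a) (odim_del dM (NM _ Na) a0).
  by move=> x /delE[/NM Mx xa]; apply/delE.
exists m.+1; split=> //; rewrite (addv_del Na).
  by apply: odimS => //; apply: perp_del.
by move=> [/mE ->]; rewrite -addv_del//; apply: NM.
Qed.

Definition fd M := exists n, odim n M.

Lemma addv_proj M a : addv M a = addv M (a - proj M a).
Proof.
have pM : addv M (a - proj M a) (proj M a) by apply: addv_sub; apply: projM.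
apply: csP => x; split; apply: addv_min; try exact: addv_sub.
  by rewrite -[X in addv _ _ X](subrK (proj M a)); apply/csD/pM/addv_mem.
by apply: csB; [apply: addv_mem|apply: addv_sub; apply: projM].
Qed.

Lemma odim_addv n M a : odim n M -> ~ M a -> odim n.+1 (addv M a).
Proof.
move=> dM Ma; rewrite addv_proj; apply: odimS => //; last exact: proj_perp.
by apply: contra_notN Ma => /eqP/subr0_eq ->; apply: projM.
Qed.

Lemma fd_addv M a : fd M -> fd (addv M a).
Proof.
move=> [n dM]; have [Ma|Ma] := pselect (M a); last first.
  by exists n.+1; apply: odim_addv.
exists n; suff -> : addv M a = M by [].
by apply: csP => x; split; [apply: addv_min|apply: addv_sub].
Qed.

(** Adjoining the vectors that build [N] one at a time keeps the algebraic sum closed. *)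
Lemma fd_sum M N : fd M -> fd N -> exists S,
  [/\ fd S, M `<=` S, N `<=` S &
      forall x, S x -> exists y z, [/\ M y, N z & x = y + z]].
Proof.
move=> fM [n]; elim: n N => [|n IH] N.
  move=> ->; exists M; split=> //.
    by move=> x /cs0E ->; apply: cs_zero.
  by move=> x Mx; exists x, 0; rewrite addr0; split=> //; apply: cs_zero.
move=> [N' [a [dN' a0 N'a ->]]]; have [S [fS MS NS hS]] := IH _ dN'.
exists (addv S a); split; first exact: fd_addv.
- by apply: subset_trans MS _; apply: addv_sub.
- apply: addv_min; last exact: addv_mem.
  by apply: subset_trans NS _; apply: addv_sub.
- move=> _ /addvE[x [c [/hS[y [z [My N'z ->]]] ->]]].
  exists y, (z + c *: a); rewrite addrA; split=> //.
  by apply/addvE; exists z, c.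
Qed.

(* The vectors [b] adjoined may be restricted by an invariant [Q], which is
   later instantiated to compatibility with an orthogonal base. *)
Lemma grow (Q : closed_subspace H -> Prop) j k N S V :
  (forall M, fd M -> Q M ->
     exists b, [/\ b != 0, perp M b & forall M', Q M' -> Q (addv M' b)]) ->
  (j <= k)%N -> odim j N -> fd S -> N `<=` S -> V `<=` S ->
  orthogonal_sets dot N V -> Q N -> Q S ->
  exists X, [/\ odim k X, N `<=` X, orthogonal_sets dot X V & Q X].
Proof.
move=> step /subnK <-; move: (k - j)%N => i.
elim: i j N S => [|i IH] j N S dN fS NS VS NV QN QS; first by exists N; split.
have [b [b0 Sb bQ]] := step S fS QS.
rewrite addSnnS; have [|||||||X [dX NX XV QX]] := IH j.+1 (addv N b) (addv S b).
- by apply: odimS => //; apply: perpS Sb.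
- exact: fd_addv.
- apply: addv_min; last exact: addv_mem.
  by apply: subset_trans NS _; apply: addv_sub.
- by apply: subset_trans VS _; apply: addv_sub.
- move=> _ y /addvE[x [c [Nx ->]]] Vy.
  by rewrite dotDl dotZl NV// (Sb _ (VS _ Vy)) mulr0 addr0.
- exact: bQ.
- exact: bQ.
- by exists X; split=> //; apply: subset_trans NX; apply: addv_sub.
Qed.

End ClosedSubspaces.

Arguments addvE {R H dot} dotn {M a x}.
Arguments cs0E {R H dot} dotn {x}.
Arguments delE {R H dot} dotn {M a x}.
Arguments capcsE {R H dot} dotn {M N x}.
Arguments addv_mem {R H dot} dotn M a.
Arguments addv_sub {R H dot} dotn M a.
Arguments addv_min {R H dot} dotn {M N a}.
Arguments projM {R H dot} dotn M z.
Arguments proj_perp {R H dot} dotn M z.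
Arguments cs0 : simpl never.
Arguments addv : simpl never.
Arguments capcs : simpl never.
Arguments del : simpl never.

(** * Orthogonal dimension and linearly independent families *)

Section Dimension.
Context (R : realType) (H : completeNormedModType R[i]).
Context (dot : {dot H for Num.conj}) (dotn : induces_norm dot).
Implicit Types (a b x y z : H) (c : nat -> R[i]) (B V W : set H).
Implicit Types (M N S : closed_subspace H).
Local Notation perp := (perp dot).
Local Notation odim := (odim dotn).
Local Notation fd := (fd dotn).

Lemma lspan_sub B : B `<=` lspan B.
Proof. by move=> x Bx V [_ BV]; apply: BV. Qed.

Lemma lspan_min B V : submod_closed [in V] -> B `<=` V -> lspan B `<=` V.
Proof. by move=> sV BV x; apply; split. Qed.

Lemma lspan_submod B : submod_closed [in lspan B].
Proof.
split; first by rewrite inE => V [sV _]; apply: submod0.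
move=> a x y; rewrite !inE => lx ly V [sV BV].
by apply: (submodL _ sV); [apply: lx|apply: ly].
Qed.

(** Families are indexed by [nat] and only their first [n] terms matter, so induction on [n] needs
    no reindexing of ordinals. *)
Let indep n (e : nat -> H) :=
  forall c, \sum_(i < n) c i *: e i = 0 -> forall i, (i < n)%N -> c i = 0.
Let spans n (e : nat -> H) V :=
  forall x, V x <-> exists c, x = \sum_(i < n) c i *: e i.

Lemma indep_odim n e : indep n e -> exists M, odim n M /\ spans n e M.
Proof.
elim: n => [|n IH] ind.
  exists (cs0 dotn); split=> // x; split=> [/(cs0E dotn) ->|[c ->]].
    by exists (fun=> 0); rewrite big_ord0.
  by rewrite big_ord0; apply: cs_zero.
have [c ec i lt_in|M [dM sM]] := IH.
  pose c' j := if j == n then 0 else c j.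
  suff /(_ i (ltnW lt_in)) : forall j, (j < n.+1)%N -> c' j = 0.
    by rewrite /c' ltn_eqF.
  apply: ind; rewrite big_ord_recr /= /c' eqxx scale0r addr0 -[RHS]ec.
  by apply: eq_bigr => j _; rewrite ltn_eqF.
exists (addv dotn M (e n)); split.
  apply: odim_addv => // /sM[c ec].
  pose c' j := if j == n then -1 else c j.
  suff /(_ n (leqnn _)) : forall j, (j < n.+1)%N -> c' j = 0.
    by move/eqP; rewrite /c' eqxx oppr_eq0 oner_eq0.
  apply: ind; rewrite big_ord_recr /= /c' eqxx scaleN1r ec; apply/eqP.
  by rewrite subr_eq0; apply/eqP/eq_bigr => j _; rewrite ltn_eqF.
move=> x; split=> [/(addvE dotn)[y [d [/sM[c ->] ->]]]|[c ->]].
  exists (fun j => if j == n then d else c j); rewrite big_ord_recr /= eqxx.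
  by congr (_ + _); apply: eq_bigr => j _; rewrite ltn_eqF.
rewrite big_ord_recr /=; apply/(addvE dotn).
exists (\sum_(i < n) c i *: e i), (c n); split=> //.
by apply/sM; exists c.
Qed.

Lemma odim_indep n M : odim n M -> exists e, indep n e /\ spans n e M.
Proof.
elim: n M => [|n IH] M /=.
  move=> ->; exists (fun=> 0); split=> // x; split=> [/(cs0E dotn) ->|[c ->]].
    by exists (fun=> 0); rewrite big_ord0.
  by rewrite big_ord0; apply: cs_zero.
move=> [M' [a [/IH[e [ind sM]] a0 M'a ->]]].
pose e' j := if j == n then a else e j.
have e'E c : \sum_(i < n) c i *: e' i = \sum_(i < n) c i *: e i.
  by apply: eq_bigr => j _; rewrite /e' ltn_eqF.
exists e'; split.
  move=> c; rewrite big_ord_recr /= e'E /e' eqxx => /eqP.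
  rewrite addr_eq0 => /eqP s0.
  have cn0 : c n = 0.
    have : M' (c n *: a).
      by rewrite -[_ *: _]opprK -s0 -scaleN1r; apply/csZ/sM; exists c.
    move=> /perp_id -/(_ dot (perpZ _ M'a))/eqP.
    by rewrite scaler_eq0 (negbTE a0) orbF => /eqP.
  move=> i; rewrite ltnS leq_eqVlt => /predU1P[->//|]; apply: ind.
  by rewrite s0 cn0 scale0r oppr0.
move=> x; split=> [/(addvE dotn)[y [d [/sM[c ->] ->]]]|[c ->]].
  pose c' j := if j == n then d else c j; exists c'.
  rewrite big_ord_recr /= e'E /c' /e' eqxx.
  by congr (_ + _); apply: eq_bigr => j _; rewrite ltn_eqF.
rewrite big_ord_recr /= e'E /e' eqxx; apply/(addvE dotn).
exists (\sum_(i < n) c i *: e i), (c n); split=> //.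
by apply/sM; exists c.
Qed.

Let ext n T (t0 : T) (e : 'I_n -> T) (i : nat) : T := oapp e t0 (insub i).

Let extE n T (t0 : T) (e : 'I_n -> T) (i : 'I_n) : ext t0 e i = e i.
Proof. by rewrite /ext valK. Qed.

Lemma lspan_rangeE n (e : 'I_n -> H) x :
  lspan (range e) x <-> exists d : 'I_n -> R[i], x = \sum_(i < n) d i *: e i.
Proof.
split.
  pose V := [set x | exists d : 'I_n -> R[i], x = \sum_(i < n) d i *: e i].
  move: x; apply: (@lspan_min _ V).
    split.
      by rewrite inE; exists (fun=> 0); rewrite big1// => i _; rewrite scale0r.
    move=> a x y; rewrite !inE => -[d ->] [d' ->].
    exists (fun i => a * d i + d' i).
    rewrite scaler_sumr -big_split/=; apply: eq_bigr => i _.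
    by rewrite scalerDl scalerA.
  move=> _ [i _ <-]; exists (fun j => (j == i)%:R).
  rewrite (bigD1 i)//= eqxx scale1r big1 ?addr0// => j /negbTE ->.
  by rewrite scale0r.
move=> [d ->]; elim/big_rec: _ => [|i y _ ly].
  exact: submod0 (lspan_submod _).
by apply: (submodL _ (lspan_submod _)) => //; apply: lspan_sub; exists i.
Qed.

Lemma has_dimP n M : has_dim n M <-> odim n M.
Proof.
split=> [[e [ind ME]]|/odim_indep[e [ind sM]]].
  have [|N [dN sN]] := @indep_odim n (ext 0 e).
    move=> c c0 i lt_in.
    apply: (ind (fun j => c (val j)) _ (Ordinal lt_in)); rewrite -[RHS]c0.
    by apply: eq_bigr => j _; rewrite extE.
  suff -> : M = N by [].
  apply: csP => x; rewrite sN ME lspan_rangeE; split=> -[d ->].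
    by exists (ext 0 d); apply: eq_bigr => j _; rewrite !extE.
  by exists (fun j => d (val j)); apply: eq_bigr => j _; rewrite extE.
exists (fun i : 'I_n => e (val i)); split.
  move=> d d0 i; rewrite -(extE 0 d); apply: ind => //; rewrite -[RHS]d0.
  by apply: eq_bigr => j _; rewrite extE.
apply/seteqP; split=> x; rewrite sM lspan_rangeE => -[d ->].
  by exists (fun j => d (val j)).
by exists (ext 0 d); apply: eq_bigr => j _; rewrite extE.
Qed.

Lemma gr_inj k (X Y : grassmannian H k) : X = Y :> closed_subspace H -> X = Y.
Proof.
case: X Y => [M dM] [N dN] /= E; case: _ / E in dN *.
by rewrite (Prop_irrelevance dM dN).
Qed.

Lemma gr_odim k (X : grassmannian H k) : odim k X.
Proof. exact/has_dimP/gr_dim. Qed.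

Lemma gr_fd k (X : grassmannian H k) : fd X.
Proof. by exists k; apply: gr_odim. Qed.

Lemma mk_gr k M : odim k M ->
  exists X : grassmannian H k, X = M :> closed_subspace H.
Proof. by move=> /has_dimP dM; exists (Grassmannian dM). Qed.

Lemma odim_le k m M : odim k M -> odim m M -> (k <= m)%N.
Proof.
elim: k m M => [|k IH] [|m] M // dM dM'.
  move: dM => [M' [a [_ a0 _ ME]]]; have : M a by rewrite ME; apply: addv_mem.
  by rewrite dM' => /(cs0E dotn)/eqP; rewrite (negbTE a0).
move: (dM) => [M' [a [_ a0 _ ME]]]; have Ma : M a by rewrite ME; apply: addv_mem.
by apply: (IH m (del dotn M a)); apply: odim_del.
Qed.

Lemma gr_sub k (X Y : grassmannian H k) : X `<=` Y -> X = Y.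
Proof.
move=> XY; have [m [dm mk mE]] := odim_sub (gr_odim Y) XY.
by apply/gr_inj/mE/eqP; rewrite eqn_leq mk (odim_le (gr_odim X) dm).
Qed.

(** * Subspaces orthogonal to a finite-dimensional space *)

Section Infinite.
Hypothesis Hinf : infinite_dimensional H.

Lemma fd_perp S : fd S -> exists2 b, b != 0 & perp S b.
Proof.
move=> [n dS]; have [z Sz] : exists z, ~ S z.
  apply: contrapT => /forallNP Sz; apply: (Hinf (n := n)).
  suff -> : [set: H] = S by apply/has_dimP.
  by apply/seteqP; split=> // x _; apply: contrapT; apply: Sz.
exists (z - proj dotn S z); last exact: proj_perp.
by apply: contra_notN Sz => /eqP/subr0_eq ->; apply: projM.
Qed.

Lemma gr_perp k S : fd S -> exists X : grassmannian H k, orthogonal_sets dot X S.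
Proof.
move=> fS; have [|||||||||M [dM _ MS _]] :=
    @grow _ _ dot dotn (fun=> True) 0 k (cs0 dotn) S S => //.
- by move=> M fM _; have [b b0 Mb] := fd_perp fM; exists b.
- by move=> x /(cs0E dotn) ->; apply: cs_zero.
- by move=> x y /(cs0E dotn) -> _; rewrite dot0l.
by have [X XM] := mk_gr dM; exists X; rewrite XM.
Qed.

(** Started from the line of [x], [grow] adjoins only vectors orthogonal to [S] and to [x]. *)
Lemma gr_perp_mem k S x : (0 < k)%N -> x != 0 -> fd S -> perp S x ->
  exists X : grassmannian H k, X x /\ orthogonal_sets dot X S.
Proof.
move=> k0 x0 fS Sx; pose N := addv dotn (cs0 dotn) x.
have [|||||||||M [dM NM MS _]] :=
    @grow _ _ dot dotn (fun=> True) 1 k N (addv dotn S x) S => //.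
- by move=> M fM _; have [b b0 Mb] := fd_perp fM; exists b.
- by apply: odimS => // y /(cs0E dotn) ->; rewrite dot0r.
- exact: fd_addv.
- apply: (addv_min dotn); last exact: addv_mem.
  by move=> y /(cs0E dotn) ->; apply: cs_zero.
- exact: addv_sub.
- move=> _ z /(addvE dotn)[y [c [/(cs0E dotn) -> ->]]] Sz.
  by rewrite add0r dotZl Sx// mulr0.
have [X XM] := mk_gr dM; exists X; rewrite XM; split=> //.
by apply: NM; exact: addv_mem.
Qed.

End Infinite.

End Dimension.

(** * The map of lines induced by an orthogonality preserving bijection *)

Section LineMap.
Context (R : realType) (H : completeNormedModType R[i]).
Context (dot : {dot H for Num.conj}) (dotn : induces_norm dot).
Hypothesis Hinf : infinite_dimensional H.
Context (k : nat) (k0 : (0 < k)%N).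
Implicit Types (a b x y z : H) (V W : set H) (S : closed_subspace H).
Implicit Types (X Y T : grassmannian H k).
Local Notation perp := (perp dot).
Local Notation orth := (orthogonal_sets dot).
Local Notation proj := (proj dotn).
Local Notation addv := (addv dotn).

Lemma orthC V W : orth V W -> orth W V.
Proof. by move=> VW x y Wx Vy; apply/dot_sym0/VW. Qed.

Lemma perp_orth V W x : orth V W -> V x -> perp W x.
Proof. by move=> VW Vx y Wy; apply: VW. Qed.

Lemma fd_line x : fd dotn (addv (cs0 dotn) x).
Proof. by apply: fd_addv; exists 0%N. Qed.

Lemma perp_line S x : orth S (addv (cs0 dotn) x) -> perp S x.
Proof. by move=> Sx y Sy; apply/dot_sym0/Sx/addv_mem. Qed.

(** The vector adjoined last in building [X] is replaced by [x]. *)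
Lemma gr_near X x : x != 0 -> perp X x ->
  exists Y, Y x /\ Y `<=` addv X x.
Proof.
move=> x0 Xx; have := gr_odim dotn X; case: (k) X k0 Xx => // n X _ Xx.
move=> [M [a [dM _ _ XM]]]; have [|Y YE] := @mk_gr _ _ _ dotn n.+1 (addv M x).
- apply: odimS => //; apply: perpS Xx; rewrite XM; exact: addv_sub.
exists Y; rewrite YE; split; first exact: addv_mem.
apply: (addv_min dotn); last exact: addv_mem.
apply: subset_trans (addv_sub _ _ _); rewrite XM; exact: addv_sub.
Qed.

Definition lmap (f : grassmannian H k -> grassmannian H k) x : set H :=
  [set z | forall T, perp T x -> perp (f T) z].

Section OneMap.
Variables (f f' : grassmannian H k -> grassmannian H k).
Hypothesis f'K : cancel f' f.
Hypothesis f_orth : forall X Y, orth X Y <-> orth (f X) (f Y).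

(** If [z] had a nonzero component orthogonal to the sum of the three images, some [T'] through that
    component would be orthogonal to the sum; [f' T'] is then an admissible [T], which forces [z] to
    be orthogonal to its own component. *)
Lemma mem_sum3 X1 X2 X3 z :
    (forall T, orth T X1 -> orth T X2 -> orth T X3 -> perp (f T) z) ->
  exists z1 z2 z3, [/\ f X1 z1, f X2 z2, f X3 z3 & z = z1 + z2 + z3].
Proof.
move=> hz.
have [S1 [fS1 XS1 XS2 hS1]] := fd_sum (gr_fd dotn (f X1)) (gr_fd dotn (f X2)).
have [S [fS SS1 XS3 hS]] := fd_sum fS1 (gr_fd dotn (f X3)).
suff /hS[y [z3 [/hS1[z1 [z2 [? ? ->]]] ? ->]]] : S z by exists z1, z2, z3.
suff /subr0_eq -> : z - proj S z = 0 by apply: projM.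
apply/eqP; apply: contraT => w0.
have [T' [T'w T'S]] := gr_perp_mem (dotn := dotn) Hinf k0 w0 fS (proj_perp _ _ _).
have T'P i : f i `<=` S -> orth (f' T') i.
  by move=> iS; apply/f_orth; rewrite f'K => u v Tu /iS; apply: T'S.
have /(_ (z - proj S z)) := hz (f' T') (T'P _ (subset_trans XS1 SS1))
  (T'P _ (subset_trans XS2 SS1)) (T'P _ XS3).
rewrite f'K => /(_ T'w) zw; case/eqP: w0; apply: (dot_eq0 (dot := dot)).
by rewrite dotBl zw sub0r (dot_sym0 (proj_perp _ _ _ _ (projM _ _ _))) oppr0.
Qed.

(** A localized [lmap]: besides orthogonality to [f X], only subspaces [T] orthogonal to the
    reference [X] are tested, so membership is easier to establish. *)
Definition lmap_at X x z : Prop :=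
  perp (f X) z /\ forall T, orth T X -> perp T x -> perp (f T) z.

(* Both sides say that [z] lies in the span of [f X], [f X'] and [f Y], where
   [Y] is a subspace of [X' + x] through [x], and is orthogonal to [f X] and
   [f X']. *)
Lemma lmap_at_swap X X' x z : x != 0 -> perp X x -> perp X' x -> orth X X' ->
  lmap_at X x z -> lmap_at X' x z.
Proof.
move=> x0 Xx X'x XX' [zX zT]; have [Y [Yx YX]] := gr_near x0 X'x.
have XY : orth X Y.
  move=> u v Xu /YX; apply: perp_addv; first exact: perp_orth XX' Xu.
  exact/dot_sym0/Xx.
have TY T : orth T X' -> perp T x -> orth T Y.
  move=> TX' Tx u v Tu /YX; apply: perp_addv; first exact: perp_orth TX' Tu.
  exact/dot_sym0/Tx.
have [T TX TX' TY'|a [a' [b [fa fa' fb zE]]]] := @mem_sum3 X X' Y z.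
  by apply: zT => // u Tu; apply/dot_sym0/TY'.
have a0 : a = 0.
  apply: (dot_eq0 (dot := dot)); have := zX _ fa; rewrite zE !dotDl.
  have /f_orth/orthC/(_ _ _ fa' fa) -> := XX'.
  by have /f_orth/orthC/(_ _ _ fb fa) -> := XY; rewrite !addr0.
split; first by apply: zT; [apply: orthC|].
move=> T TX' Tx; rewrite zE a0 add0r; apply: perpD => u fu.
  by have /f_orth/orthC/(_ _ _ fa' fu) -> := TX'.
by have /f_orth/orthC/(_ _ _ fb fu) -> := TY _ TX' Tx.
Qed.

Lemma gr_perp2 X Y x : exists T, [/\ orth T X, orth T Y & perp T x].
Proof.
have [S [fS XS YS _]] := fd_sum (gr_fd dotn X) (gr_fd dotn Y).
have [T TS] := gr_perp Hinf k (fd_addv x fS); exists T; split.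
- by move=> u v Tu /XS/(addv_sub dotn S x); apply: TS.
- by move=> u v Tu /YS/(addv_sub dotn S x); apply: TS.
- by move=> u Tu; apply/dot_sym0/TS => //; apply: addv_mem.
Qed.

(** To test an arbitrary [Y], the reference is moved from [X] to a subspace [X'] orthogonal to [X],
    [Y] and [x], and from there to [Y]. *)
Lemma lmapE X x z : x != 0 -> perp X x -> lmap f x z <-> lmap_at X x z.
Proof.
move=> x0 Xx; split=> [hz|hz Y Yx]; first by split=> [|T _]; apply: hz.
have [X' [X'X X'Y X'x]] := gr_perp2 X Y x.
have /lmap_at_swap hX' := lmap_at_swap x0 Xx X'x (orthC X'X) hz.
by have [] := hX' Y x0 X'x Yx X'Y.
Qed.

Lemma lmap_sub X x : X x -> lmap f x `<=` f X.
Proof.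
move=> Xx z hz; have [T TX _ _|a [a' [b [fa fa' fb ->]]]] := @mem_sum3 X X X z.
  by apply: hz => u Tu; apply/dot_sym0/TX.
by do 2?[apply: csD].
Qed.

Lemma lmap_perp x y u v : x != 0 -> y != 0 -> dot x y = 0 ->
  lmap f x u -> lmap f y v -> dot u v = 0.
Proof.
move=> x0 y0 xy xu yv.
have [||X [Xy Xx]] := gr_perp_mem (dotn := dotn) Hinf k0 y0 (S := addv (cs0 dotn) x).
- exact: fd_line.
- by apply: perp_addv; [move=> w /(cs0E dotn) ->; rewrite dot0r|apply: dot_sym0].
by apply: xu (lmap_sub Xy yv); apply: perp_line.
Qed.

End OneMap.

Section Inverse.
Variables (f f' : grassmannian H k -> grassmannian H k).
Hypotheses (fK : cancel f f') (f'K : cancel f' f).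
Hypothesis f_orth : forall X Y, orth X Y <-> orth (f X) (f Y).

Lemma inv_orth X Y : orth X Y <-> orth (f' X) (f' Y).
Proof. by rewrite (f_orth (f' X)) !f'K. Qed.

(** A subspace [W] through [x] inside [addv X x] differs from [X], so [f W] is not contained in
    [f X]. A vector of [f W] outside [f X], minus its projection to [f X], passes the localized
    test. *)
Lemma lmap_nz x : x != 0 -> exists2 z, lmap f x z & z != 0.
Proof.
move=> x0; have [X XS] := gr_perp Hinf k (fd_line x).
have Xx := perp_line XS; have [W [Wx WX]] := gr_near x0 Xx.
have [y fy Xy] : exists2 y, f W y & ~ f X y.
  apply: contrapT => h; have /(gr_sub dotn)/(can_inj fK) WX' : f W `<=` f X.
    by move=> y fy; apply: contrapT => ?; apply: h; exists y.
  by move: Wx; rewrite WX' => /Xx/(dot_eq0 (dot := dot)); move/eqP: x0.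
exists (y - proj (f X) y); last first.
  by apply: contra_notN Xy => /eqP/subr0_eq ->; apply: projM.
apply/(lmapE f'K f_orth _ x0 Xx); split; first exact: proj_perp.
move=> T TX Tx; have TW : orth T W.
  move=> u v Tu /WX; apply: perp_addv; first exact: perp_orth TX Tu.
  exact/dot_sym0/Tx.
apply: perpB => u fu.
  by have /f_orth/orthC/(_ _ _ fy fu) -> := TW.
by have /f_orth/orthC/(_ _ _ (projM _ _ _) fu) -> := TX.
Qed.

End Inverse.

Section InverseLine.
Variables (f f' : grassmannian H k -> grassmannian H k).
Hypotheses (fK : cancel f f') (f'K : cancel f' f).
Hypothesis f_orth : forall X Y, orth X Y <-> orth (f X) (f Y).

(** A nonzero [u] in [lmap f' y] is orthogonal to every [Y] orthogonal to [x]. The part [w] of [u]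
    orthogonal to [x] vanishes, since otherwise such a [Y] could be taken through [w]; so [u] is a
    multiple of [x]. *)
Lemma lmap_inv x y : x != 0 -> y != 0 -> lmap f x y -> lmap f' y x.
Proof.
move=> x0 y0 xy.
have [u yu u0] := lmap_nz f'K fK (inv_orth f'K f_orth) y0.
pose w := u - (dot u x / dot x x) *: x.
have wx : dot w x = 0 by rewrite dotBl dotZl divfK ?dot_neq0// subrr.
have [w0|w0] := eqVneq w 0.
  have uE := subr0_eq w0; set c := _ / _ in uE.
  have c0 : c != 0 by apply: contraNneq u0 => c0; rewrite uE c0 scale0r.
  move=> T /yu; rewrite uE => h v /h.
  by rewrite dotZl => /eqP; rewrite mulf_eq0 (negbTE c0) => /eqP.
have [||Y [Yw Yx]] := gr_perp_mem (dotn := dotn) Hinf k0 w0 (S := addv (cs0 dotn) x).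
- exact: fd_line.
- by apply: perp_addv => // v /(cs0E dotn) ->; rewrite dot0r.
have /(_ Y) : forall Y, perp Y x -> perp Y u.
  by move=> Y' Y'x; rewrite -[Y']fK; apply: yu; apply: xy.
move=> /(_ (perp_line Yx) w Yw) uw; case/eqP: w0.
apply: (dot_eq0 (dot := dot)); rewrite {1}/w dotBl dotZl uw.
by rewrite (dot_sym0 wx) mulr0 subr0.
Qed.

End InverseLine.

End LineMap.

(** * Extension to closed subspaces, and its uniqueness *)

Section Extension.
Context (R : realType) (H : completeNormedModType R[i]).
Context (dot : {dot H for Num.conj}) (dotn : induces_norm dot).
Hypothesis Hinf : infinite_dimensional H.
Context (k : nat) (k0 : (0 < k)%N).
Implicit Types (x y z : H) (M N : closed_subspace H) (X Y : grassmannian H k).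
Local Notation perp := (perp dot).
Local Notation orth := (orthogonal_sets dot).

(** A relation, since the image of a vector is determined only up to a nonzero scalar. *)
Definition lrel (f : grassmannian H k -> grassmannian H k) x y : Prop :=
  [/\ x != 0, y != 0 & lmap dot f x y].

(** The complement of the image of the complement of [M]; in this form it is a closed subspace at
    once. *)
Definition extend f M : closed_subspace H :=
  cs_perp dotn [set y | exists2 x, lrel f x y & perp M x].

Section OneMap.
Variables (f f' : grassmannian H k -> grassmannian H k).
Hypotheses (fK : cancel f f') (f'K : cancel f' f).
Hypothesis f_orth : forall X Y, orth X Y <-> orth (f X) (f Y).

Lemma lrel_total x : x != 0 -> exists y, lrel f x y.
Proof.
move=> x0; have [y xy y0] := lmap_nz dotn Hinf k0 fK f'K f_orth x0.
by exists y.
Qed.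

Lemma lrel_inv x y : lrel f x y -> lrel f' y x.
Proof.
by move=> [x0 y0 xy]; split=> //; apply: (lmap_inv dotn Hinf k0 fK f'K f_orth).
Qed.

Lemma lrel_perp x y x' y' : lrel f x y -> lrel f x' y' ->
  dot x x' = 0 -> dot y y' = 0.
Proof.
move=> [x0 _ xy] [x'0 _ xy'] xx'.
exact: (lmap_perp dotn Hinf k0 f'K f_orth x0 x'0 xx' xy xy').
Qed.

Lemma lrel_gr X x y : lrel f x y -> X x -> f X y.
Proof.
by move=> [x0 _ xy] Xx; apply: (lmap_sub dotn Hinf k0 f'K f_orth Xx).
Qed.

End OneMap.

Section Inverse.
Variables (f f' : grassmannian H k -> grassmannian H k).
Hypotheses (fK : cancel f f') (f'K : cancel f' f).
Hypothesis f_orth : forall X Y, orth X Y <-> orth (f X) (f Y).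
Let f'_orth : forall X Y, orth X Y <-> orth (f' X) (f' Y) := inv_orth f'K f_orth.

Lemma extendE M x y : lrel f x y -> extend f M y <-> M x.
Proof.
move=> xy; split=> [hy|Mx y' [x' xy' Mx']]; last first.
  exact: (lrel_perp f'K f_orth xy xy' (dot_sym0 (Mx' _ Mx))).
apply: (biperp dotn) => x' Mx'; have [->|x'0] := eqVneq x' 0; first exact: dot0r.
have [y' xy'] := lrel_total fK f'K f_orth x'0.
apply: (lrel_perp fK f'_orth (lrel_inv fK f'K f_orth xy)
  (lrel_inv fK f'K f_orth xy')).
by apply: hy; exists x'.
Qed.

End Inverse.

Lemma extendK (f f' : grassmannian H k -> grassmannian H k)
    (fK : cancel f f') (f'K : cancel f' f)
    (f_orth : forall X Y, orth X Y <-> orth (f X) (f Y)) :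
  cancel (extend f) (extend f').
Proof.
move=> M; apply: csP => x; have [->|x0] := eqVneq x 0.
  by split=> _; apply: cs_zero.
have [y xy] := lrel_total fK f'K f_orth x0.
rewrite (extendE f'K fK (inv_orth f'K f_orth) _ (lrel_inv fK f'K f_orth xy)).
exact: (extendE fK f'K f_orth _ xy).
Qed.

Lemma orth_extension (f f' : grassmannian H k -> grassmannian H k)
    (fK : cancel f f') (f'K : cancel f' f)
    (f_orth : forall X Y, orth X Y <-> orth (f X) (f Y)) :
  exists g, logic_automorphism dotn g /\ forall X, g X = f X.
Proof.
have f'_orth := inv_orth f'K f_orth.
have srel y : y != 0 -> exists x, lrel f x y.
  move=> y0; have [x yx] := lrel_total f'K fK f'_orth y0.
  by exists x; apply: (lrel_inv f'K fK f'_orth).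
(* Every nonzero vector is related to some [x], so inclusions of closed subspaces need only be
   checked on related pairs, where [extendE] applies. *)
have rsub M N : (forall x y, lrel f x y -> M y -> N y) -> M `<=` N.
  move=> h y My; have [->|y0] := eqVneq y 0; first exact: cs_zero.
  by have [x xy] := srel _ y0; apply: h xy My.
have rE M N : (forall x y, lrel f x y -> M y <-> N y) -> M = N.
  by move=> h; apply/cs_inj/seteqP; split; apply: rsub => x y xy; case: (h x y xy).
exists (extend f); split; first split.
- by exists (extend f'); apply: extendK.
- move=> M N; split=> [MN|MN x Mx].
    by apply: rsub => x y xy; rewrite !(extendE fK f'K f_orth _ xy); apply: MN.
  have [->|x0] := eqVneq x 0; first exact: cs_zero.
  have [y xy] := lrel_total fK f'K f_orth x0.
  by apply/(extendE fK f'K f_orth N xy)/MN/(extendE fK f'K f_orth M xy).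
- move=> M; apply: rE => x y xy; rewrite (extendE fK f'K f_orth _ xy).
  split=> [Mx y' My'|My x' Mx'].
    have [->|y'0] := eqVneq y' 0; first exact: dot0r.
    have [x' xy'] := srel _ y'0; apply: (lrel_perp f'K f_orth xy xy').
    by apply: Mx; apply/(extendE fK f'K f_orth M xy').
  have [->|x'0] := eqVneq x' 0; first exact: dot0r.
  have [y' xy'] := lrel_total fK f'K f_orth x'0.
  apply: (lrel_perp fK f'_orth (lrel_inv fK f'K f_orth xy)
  (lrel_inv fK f'K f_orth xy')).
  by apply: My; apply/(extendE fK f'K f_orth M xy').
- move=> X; apply: rE => x y xy; rewrite (extendE fK f'K f_orth _ xy).
  split=> [|fXy]; first exact: (lrel_gr f'K f_orth xy).
  rewrite -[X]fK; exact: (lrel_gr fK f'_orth (lrel_inv fK f'K f_orth xy) fXy).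
Qed.

Lemma automorphism_sub (g g' : closed_subspace H -> closed_subspace H) :
    logic_automorphism dotn g -> logic_automorphism dotn g' ->
    (forall X, g X = g' X) -> forall M, g M `<=` g' M.
Proof.
move=> [gbij gS _] [g'bij g'S _] gg'.
have surj h N : bijective h -> exists M, h M = N.
  by move=> [h' _ h'K]; exists (h' N).
pose line := addv dotn (cs0 dotn).
have line_sub x M : M x -> line x `<=` M.
  by move=> Mx; apply: (addv_min dotn) => // y /(cs0E dotn) ->; apply: cs_zero.
(* If the component [w] of [y] orthogonal to the line were nonzero, an [X] through [x] and
   orthogonal to [w] would contain [y], making [y] orthogonal to [w]. *)
have line_cap x y : x != 0 -> (forall X, X x -> X y) -> line x y.
  move=> x0 hy; suff /subr0_eq -> : y - proj dotn (line x) y = 0 by apply: projM.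
  set w := y - _; apply/eqP; apply: contraT => w0.
  have wx : dot w x = 0 by apply: (proj_perp dotn (line x)); apply: addv_mem.
  have [||X [/hy Xy Xw]] := gr_perp_mem (dotn := dotn) Hinf k0 x0 (S := line w).
  - exact: fd_line.
  - by apply: perp_addv; [move=> v /(cs0E dotn) ->; rewrite dot0r|apply: dot_sym0].
  have yw := Xw _ _ Xy (addv_mem dotn (cs0 dotn) w).
  case/eqP: w0; apply: (dot_eq0 (dot := dot)); rewrite {1}/w dotBl yw sub0r.
  by rewrite (dot_sym0 (proj_perp dotn _ _ _ (projM dotn _ _))) oppr0.
(* Writing [g (line x)] as [g' N], every [X] through [x] contains [N] because [g X = g' X]; so [N]
   lies in the line. *)
have lineS x : x != 0 -> g (line x) `<=` g' (line x).
  move=> x0; have [N gN] := surj g' (g (line x)) g'bij; rewrite -gN.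
  apply/(proj1 (g'S _ _)).
  move=> y Ny; apply: line_cap => // X /line_sub/(proj1 (gS _ _)).
  by rewrite gg' -gN => /(proj2 (g'S _ _)); apply.
(* Now [g M = g' N]; for nonzero [y] in [N] the case of lines puts [g (line y)] inside [g M], hence
   [y] in [M]. *)
move=> M; have [N gN] := surj g' (g M) g'bij; rewrite -gN.
apply/(proj1 (g'S _ _)) => y Ny.
have [->|y0] := eqVneq y 0; first exact: cs_zero.
suff /(proj2 (gS _ _)) : g (line y) `<=` g M by apply; apply: addv_mem.
by apply: subset_trans (lineS _ y0) _; rewrite -gN; apply/(proj1 (g'S _ _))/line_sub.
Qed.

Lemma automorphism_eq (g g' : closed_subspace H -> closed_subspace H) :
    logic_automorphism dotn g -> logic_automorphism dotn g' ->
    (forall X, g X = g' X) -> g = g'.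
Proof.
move=> ag ag' gg'; apply/funext => M; apply/cs_inj/seteqP.
by split; apply: automorphism_sub.
Qed.

End Extension.

(** * Compatibility and apartments *)

Section Compatibility.
Context (R : realType) (H : completeNormedModType R[i]).
Context (dot : {dot H for Num.conj}) (dotn : induces_norm dot).
Implicit Types (b x y z : H) (B : set H) (M N : closed_subspace H).
Local Notation perp := (perp dot).
Local Notation proj := (proj dotn).
Local Notation odim := (odim dotn).
Local Notation fd := (fd dotn).
Local Notation del := (del dotn).
Local Notation addv := (addv dotn).

(** A one-sided form of commutation of the two projections; [stable_sym] gives its symmetry. *)
Definition stable M N : Prop := forall x, M x -> M (proj N x).

Lemma stable_perp M N x : stable M N -> perp M x -> perp M (proj N x).
Proof. by move=> MN Mx y My; rewrite dot_proj; apply/Mx/MN. Qed.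

(** As [proj N] is self-adjoint, it also preserves the complement of [M]. Applied to the
    decomposition of a vector [y] of [N] along [M], it therefore fixes [proj M y]. *)
Lemma stable_sym M N : stable M N -> stable N M.
Proof.
move=> MN y Ny; suff -> : proj M y = proj N (proj M y) by apply: projM.
apply: proj_uniq; first exact/MN/projM.
have -> : y - proj N (proj M y) = proj N (y - proj M y).
  by rewrite projB (proj_id dotn Ny).
exact/stable_perp/proj_perp.
Qed.

Lemma compatibleP M N : compatible dot M N <-> stable M N.
Proof.
split=> [[M' [N' [oM oN oMN EM EN]]] x|MN].
  rewrite {1}EM => -[x' M'x' [a [Ma Na] <-]].
  suff -> : proj N (x' + a) = a by [].
  apply: proj_uniq => // y; rewrite addrK EN => -[y' N'y' [c cMN <-]].
  by rewrite dotDr oMN// add0r; apply/dot_sym0/oM.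
have NM := stable_sym MN.
exists (capcs dotn M (cs_perp dotn N)), (capcs dotn N (cs_perp dotn M)); split.
- by move=> a y [Ma Na] /(capcsE dotn)[_ /(_ _ Na)/dot_sym0].
- by move=> a y [Ma Na] /(capcsE dotn)[_ /(_ _ Ma)/dot_sym0].
- by move=> a y /(capcsE dotn)[Ma Na] /(capcsE dotn)[Ny _]; apply: Na.
- apply/seteqP; split=> [x Mx|_ [a /(capcsE dotn)[Ma _] [c [Mc _] <-]]]; last first.
    exact: csD.
  exists (x - proj N x); first apply/(capcsE dotn).
    split; last exact: proj_perp.
    by apply: csB => //; apply: MN.
  by exists (proj N x); rewrite ?subrK//; split; [apply: MN|apply: projM].
- apply/seteqP; split=> [x Nx|_ [a /(capcsE dotn)[Na _] [c [_ Nc] <-]]]; last first.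
    exact: csD.
  exists (x - proj M x); first apply/(capcsE dotn).
    split; last exact: proj_perp.
    by apply: csB => //; apply: NM.
  by exists (proj M x); rewrite ?subrK//; split; [apply: projM|apply: NM].
Qed.

(** For finite-dimensional [M] and an orthogonal base [B] this means that [M] is spanned by members
    of [B], but it makes sense before [B] is known to be a base. *)
Definition adapted B M : Prop := forall b, B b -> M b \/ perp M b.

Lemma perp_proj_adapted B M x : adapted B M -> perp B x -> perp B (proj M x).
Proof.
move=> BM Bx b Bb; rewrite dot_proj; case: (BM b Bb) => [Mb|Mb].
  by rewrite proj_id//; apply: Bx.
by rewrite proj_eq0// dot0r.
Qed.

(** * A common base for compatible subspaces *)

Section CommonBase.
Variable C : set (closed_subspace H).
Hypotheses (C_fd : forall M, C M -> fd M).
Hypothesis C_stable : forall M N, C M -> C N -> stable M N.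

(* A minimal nonzero subspace stable under all projections onto members of [C]
   lies in or is orthogonal to each of them. *)
Lemma adapted_vec n N : odim n N -> (exists2 x, N x & x != 0) ->
    (forall M, C M -> stable N M) ->
  exists x, [/\ x != 0, N x & forall M, C M -> M x \/ perp M x].
Proof.
elim/ltn_ind: n N => n IH N dN [x Nx x0] sN.
have [h|] := pselect (forall M, C M -> M x \/ perp M x); first by exists x.
move=> /existsNP[M /not_implyP[CM /not_orP[Mx pMx]]].
pose N' := capcs dotn N M.
have N'N : N' `<=` N by move=> y /(capcsE dotn)[].
have [m [dN' mn mE]] := odim_sub dN N'N.
have mlt : (m < n)%N.
  rewrite ltn_neqAle mn andbT; apply: contra_notN Mx => /eqP/mE NN'.
  by move: Nx; rewrite -NN' => /(capcsE dotn)[].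
have [||y [y0 N'y hy]] := IH m mlt N' dN'.
- exists (proj M x).
    by apply/(capcsE dotn); split; [apply: sN|apply: projM].
  by apply: contra_notN pMx => /eqP p0; rewrite -[x]subr0 -p0; apply: proj_perp.
- move=> M' CM' z /(capcsE dotn)[Nz Mz]; apply/(capcsE dotn).
  by split; [apply: sN|apply: C_stable].
by exists y; split=> //; apply: N'N.
Qed.

(** A maximal orthogonal family adapted to all of [C] has dense span: a nonzero vector orthogonal to
    it either is orthogonal to every member of [C] and could be added, or has a nonzero projection
    to some [M], and then [adapted_vec] finds an addable vector in the part of [M] orthogonal to
    [B]. *)
Lemma common_base : exists2 B, orthogonal_base dot B &
  forall M, C M -> adapted B M.
Proof.
pose P B := [/\ ~ B 0, forall x y, B x -> B y -> x <> y -> dot x y = 0 &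
  forall M, C M -> adapted B M].
have [|B [[B0 Borth BC] Bmax]] := @Zorn_bigcup _ P.
  move=> F FP Ftot; split.
  - by move=> [B FB B0]; have [] := FP _ FB.
  - move=> x y [B FB Bx] [B' FB' By].
    have [BB'|BB'] := Ftot _ _ FB FB'.
      by have [_ + _] := FP _ FB'; apply => //; apply: BB'.
    by have [_ + _] := FP _ FB; apply => //; apply: BB'.
  - by move=> M CM b [B FB Bb]; have [_ _ /(_ M CM)] := FP _ FB; apply.
have maxE x : perp B x -> (forall M, C M -> M x \/ perp M x) -> x = 0.
  move=> Bx xC; apply: contrapT => /eqP x0.
  apply: (Bmax (B `|` [set x])).
    split; first by move=> y; left.
    by move=> /(_ x (or_intror erefl)) /Bx/(dot_eq0 (dot := dot)); apply/eqP.
  split.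
  - by move=> [//|/= /esym]; apply/eqP.
  - move=> y z [By|->] [Bz|->] => [||_|//]; first exact: Borth.
      by move=> _; apply/dot_sym0/Bx.
    exact: Bx.
  - by move=> M CM b [|->]; [apply: BC|apply: xC].
exists B => //; split=> //; apply/seteqP; split=> // z _.
have [p pB zp] := closure_proj dotn z (lspan_submod B).
suff /subr0_eq -> : z - p = 0 by [].
have {zp}: perp B (z - p) by apply: perpS zp; apply: lspan_sub.
move: (z - p) => w Bw; have [h|] := pselect (forall M, C M -> perp M w).
  by apply: maxE => // M /h; right.
move=> /existsNP[M /not_implyP[CM pMw]]; exfalso.
pose N := capcs dotn M (cs_perp dotn B).
have [n dM] := C_fd CM; have [|m [dN _ _]] := @odim_sub _ _ _ dotn _ _ N dM.
  by move=> y /(capcsE dotn)[].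
have [||x [x0 /(capcsE dotn)[_ Bx] xC]] := adapted_vec dN.
- exists (proj M w).
    apply/(capcsE dotn); split; first exact: projM.
    by apply: perp_proj_adapted Bw; apply: BC.
  by apply: contra_notN pMw => /eqP p0; rewrite -[w]subr0 -p0; apply: proj_perp.
- move=> M' CM' y /(capcsE dotn)[My By]; apply/(capcsE dotn).
  split; first exact: C_stable.
  by apply: perp_proj_adapted By; apply: BC.
by case/eqP: x0; apply: maxE.
Qed.

End CommonBase.

Lemma adapted0 B : adapted B (cs0 dotn).
Proof. by move=> b _; right=> x /(cs0E dotn) ->; rewrite dot0r. Qed.

(** * Subspaces adapted to a fixed base *)

Section Base.
Context (B : set H) (Bb : orthogonal_base dot B).

Lemma base_neq0 b : B b -> b != 0.
Proof. by case: Bb => B0 _ _ Bx; apply/eqP => b0; apply: B0; rewrite -b0. Qed.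

Lemma base_perp0 x : perp B x -> x = 0.
Proof.
move=> Bx; apply: (dot_eq0 (dot := dot)).
suff : cs_perp dotn [set x] x by apply.
apply: (@cs_closed _ _ (cs_perp dotn [set x])); case: Bb => _ _ Bd.
have : closure (lspan B) x by rewrite Bd.
apply: closure_subset; apply: lspan_min; first exact: cs_submod.
by move=> b Bb' _ ->; apply/dot_sym0/Bx.
Qed.

Lemma adapted_addv M b : adapted B M -> B b -> adapted B (addv M b).
Proof.
move=> BM Bb' b1 Bb1; have [->|/eqP b1b] := eqVneq b1 b.
  by left; apply: addv_mem.
have [|Mb1] := BM _ Bb1; first by left; apply: addv_sub.
by right; apply: perp_addv => //; case: Bb => _ + _; apply.
Qed.

Lemma adapted_del M b : adapted B M -> B b -> adapted B (del M b).
Proof.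
move=> BM Bb' b1 Bb1; have [->|/eqP b1b] := eqVneq b1 b.
  by right; apply: perp_del.
have [Mb1|Mb1] := BM _ Bb1; last by right; apply: perpS Mb1; apply: del_sub.
by left; apply/(delE dotn); split=> //; case: Bb => _ + _; apply.
Qed.

(** Both projections fix or kill each base vector, so by self-adjointness
    [proj N x - proj M (proj N x)] is orthogonal to all of [B]. *)
Lemma adapted_stable M N : adapted B M -> adapted B N -> stable M N.
Proof.
move=> BM BN x Mx.
suff /subr0_eq -> : proj N x - proj M (proj N x) = 0 by apply: projM.
apply: base_perp0 => b Bb'; rewrite dotBl (dot_proj dotn M).
have [Mb|Mb] := BM b Bb'.
  by rewrite (proj_id dotn Mb) subrr.
rewrite (proj_eq0 dotn Mb) dot0r subr0 dot_proj; case: (BN b Bb') => [Nb|Nb].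
  by rewrite proj_id//; apply/dot_sym0/Mb.
by rewrite proj_eq0// dot0r.
Qed.

(* If the members of the family separate the base vectors then each of these
   is an eigenvector of the projection onto [M]. *)
Lemma separated_adapted (F : set (closed_subspace H)) M :
    (forall W, F W -> stable W M) ->
    (forall b b', B b -> B b' -> b <> b' ->
       exists2 W, F W & W b /\ perp W b' \/ W b' /\ perp W b) ->
  adapted B M.
Proof.
move=> FM Fsep b Bb'.
have pb b' : B b' -> b <> b' -> dot (proj M b) b' = 0.
  move=> Bb'' bb'; have [W FW [[Wb Wb']|[Wb' Wb]]] := Fsep b b' Bb' Bb'' bb'.
    by apply/dot_sym0/Wb'/FM.
  by apply: (stable_perp (FM _ FW) Wb).
pose c := dot (proj M b) b / dot b b.
have pbE : proj M b = c *: b.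
  apply/eqP; rewrite -subr_eq0; apply/eqP/base_perp0 => b' Bb''.
  have [->|/eqP bb'] := eqVneq b' b.
    by rewrite dotBl dotZl divfK ?dot_neq0 ?base_neq0// subrr.
  case: Bb => _ Bo _.
  by rewrite dotBl dotZl pb// ?Bo// ?mulr0 ?subr0//; apply/nesym.
have [c0|c0] := eqVneq c 0.
  right; rewrite -[b]subr0 -[0](scale0r b) -c0 -pbE; exact: proj_perp.
left; rewrite -[b]scale1r -(mulVf c0) -scalerA -pbE; apply: csZ; exact: projM.
Qed.

(** Some base vector is not orthogonal to a given nonzero vector of [M]; by adaptedness it lies in
    [M] and can be split off. *)
Lemma adapted_lspan n M : odim n M -> adapted B M ->
  M = lspan (B `&` M) :> set H.
Proof.
move=> dM BM; apply/seteqP; split; last first.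
  by apply: lspan_min; [apply: cs_submod|move=> x []].
elim: n M dM BM => [|n IH] M dM BM.
  by move: dM => -> x /(cs0E dotn) ->; apply: submod0 (lspan_submod _).
have [[x Mx x0]|M0] := cs_nz dotn M; last first.
  by rewrite M0 => x /(cs0E dotn) ->; apply: submod0 (lspan_submod _).
have [b Bb' xb] : exists2 b, B b & dot x b <> 0.
  apply: contrapT => h; case/eqP: x0; apply: base_perp0 => b Bb'.
  by apply: contrapT => xb; apply: h; exists b.
have Mb : M b by case: (BM b Bb') => // /(_ x Mx)/dot_sym0.
move=> y; rewrite {1}(addv_del dotn Mb) => /(addvE dotn)[z [c [Mz ->]]].
have sM := lspan_submod (B `&` M); apply: (submodD sM).
  move: z Mz; apply: subset_trans (IH _ (odim_del dM Mb (base_neq0 Bb')) _) _.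
    exact: adapted_del.
  apply: lspan_min => // b' [Bb'' /(delE dotn)[Mb' _]].
  exact: lspan_sub.
by apply: (submodZ _ sM); apply: lspan_sub.
Qed.

Lemma lspan_adapted S M : S `<=` B -> M = lspan S :> set H -> adapted B M.
Proof.
move=> SB ME b Bb'; rewrite ME; have [Sb|Sb] := pselect (S b).
  by left; apply: lspan_sub.
right=> y lSy; apply: dot_sym0.
suff : cs_perp dotn [set b] y by apply.
move: y lSy; apply: lspan_min; first exact: cs_submod.
move=> s Ss _ ->; case: Bb => _ + _; apply=> //; first exact: SB.
by move=> sb; apply: Sb; rewrite -sb.
Qed.

End Base.

End Compatibility.

(** * Orthogonal apartments *)

Section Apartments.
Context (R : realType) (H : completeNormedModType R[i]).
Context (dot : {dot H for Num.conj}) (dotn : induces_norm dot).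
Hypothesis Hinf : infinite_dimensional H.
Context (k : nat) (k0 : (0 < k)%N).
Implicit Types (b c x y z : H) (B : set H) (S : closed_subspace H).
Implicit Types (X Y T W : grassmannian H k) (A : set (grassmannian H k)).
Local Notation perp := (perp dot).
Local Notation orth := (orthogonal_sets dot).
Local Notation proj := (proj dotn).
Local Notation addv := (addv dotn).
Local Notation del := (del dotn).
Local Notation base := (orthogonal_base dot).
Local Notation compatible := (compatible dot).
Local Notation adapted := (adapted dot).

Definition apt B : set (grassmannian H k) := [set X | adapted B X].

Lemma apartmentP A :
  orthogonal_apartment dot A <-> exists2 B, base B & A = apt B.
Proof.
have aptE B : base B -> [set X : grassmannian H k |
    exists2 S : set H, S `<=` B & (X : set H) = lspan S] = apt B.
  move=> Bb; apply/seteqP; split=> X /=; first by move=> [S]; apply: lspan_adapted.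
  move=> BX; exists (B `&` X); first exact: subIsetl.
  exact: (adapted_lspan Bb (gr_odim dotn X) BX).
by split=> -[B Bb ->]; exists B => //; rewrite aptE.
Qed.

Lemma gr_common_base A : (forall X Y, A X -> A Y -> compatible X Y) ->
  exists2 B, base B & A `<=` apt B.
Proof.
move=> hA; pose C := [set gr_cs X | X in A].
have [||B Bb AB] := common_base (dotn := dotn) (C := C).
- by move=> _ [X _ <-]; apply: gr_fd.
- by move=> _ _ [X AX <-] [Y AY <-]; apply/(compatibleP dotn)/hA.
by exists B => // X AX; apply: AB; exists X.
Qed.

Lemma compatible_sym X Y : compatible X Y -> compatible Y X.
Proof. by move=> /(compatibleP dotn)/stable_sym/(compatibleP dotn). Qed.

Lemma gr_common_base2 X Y : compatible X Y ->
  exists2 B, base B & apt B X /\ apt B Y.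
Proof.
move=> XY; have [|B Bb sub] := @gr_common_base [set X; Y].
  move=> Z Z' [->|->] [->|->] //; try exact: compatible_sym;
  by apply/(compatibleP dotn) => x xZ; rewrite proj_id.
by exists B => //; split; apply: sub; [left|right].
Qed.

Section Base.
Context B (Bb : base B).

Lemma base_notin S : fd dotn S -> exists2 b, B b & ~ S b.
Proof.
move=> /(fd_perp Hinf)[z z0 Sz]; apply: contrapT => h.
case/eqP: z0; apply: (base_perp0 dotn Bb); apply: perpS Sz => b Bb'.
by apply: contrapT => Sb; apply: h; exists b.
Qed.

(** The instance of [grow] that adjoins only base vectors, which keeps the subspaces adapted. *)
Lemma apt_through S b : B b -> fd dotn S -> adapted B S -> perp S b ->
  exists X, [/\ apt B X, X b & orth X S].
Proof.
move=> Bb' fS BS Sb; pose N := addv (cs0 dotn) b.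
have N0 : adapted B (cs0 dotn) by apply: adapted0.
have [|||||||||M [dM NM MS BM]] :=
    @grow _ _ dot dotn (adapted B) 1 k N (addv S b) S => //.
- move=> M fM BM; have [b' Bb'' Mb'] := base_notin fM.
  exists b'; split; first exact: (base_neq0 Bb).
    by case: (BM _ Bb'').
  by move=> M' BM'; apply: adapted_addv.
- apply: odimS => //; first exact: (base_neq0 Bb).
  by move=> y /(cs0E dotn) ->; rewrite dot0r.
- exact: fd_addv.
- apply: (addv_min dotn); last exact: addv_mem.
  by move=> y /(cs0E dotn) ->; apply: cs_zero.
- exact: addv_sub.
- move=> _ z /(addvE dotn)[y [c [/(cs0E dotn) -> ->]]] Sz.
  by rewrite add0r dotZl Sb// mulr0.
- exact: adapted_addv.
- exact: adapted_addv.
have [X XM] := mk_gr dM; exists X; rewrite /apt /= XM; split=> //.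
by apply: NM; apply: addv_mem.
Qed.

Lemma apt_separates b b' : B b -> B b' -> b <> b' ->
  exists X, [/\ apt B X, X b & perp X b'].
Proof.
move=> Bb1 Bb2 bb'.
have [|||X [BX Xb Xb']] := @apt_through (addv (cs0 dotn) b') b Bb1.
- exact: fd_line.
- by apply: adapted_addv => //; apply: adapted0.
- apply: perp_addv; first by move=> y /(cs0E dotn) ->; rewrite dot0r.
  by case: Bb => _ + _; apply.
by exists X; split=> // y Xy; apply/dot_sym0/Xb' => //; apply: addv_mem.
Qed.

Lemma mem_perp X b : B b -> X b -> ~ perp X b.
Proof. by move=> /(base_neq0 Bb) b0 Xb /(perp_id Xb); apply/eqP. Qed.

Lemma apt_compatible X Y : apt B X -> apt B Y -> compatible X Y.
Proof. by move=> BX BY; apply/(compatibleP dotn)/(adapted_stable dotn Bb). Qed.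

(** The apartment separates any two base vectors, so [separated_adapted] applies. *)
Lemma apt_max X : (forall Y, apt B Y -> compatible Y X) -> apt B X.
Proof.
move=> hX; pose F := [set gr_cs Y | Y in apt B].
apply: (separated_adapted (dotn := dotn) Bb (F := F)).
  by move=> _ [Y BY <-]; apply/(compatibleP dotn)/hX.
move=> b b' Bb1 Bb2 bb'; have [Y [BY Yb Yb']] := apt_separates Bb1 Bb2 bb'.
by exists Y; [exists Y|left].
Qed.

(** * Traces on an apartment *)

Definition trace A T : set (grassmannian H k) :=
  [set W | A W /\ compatible W T].

Definition unsep b b' : set (grassmannian H k) :=
  [set W | apt B W /\ (W b <-> W b')].

Lemma unsepC b b' : unsep b b' = unsep b' b.
Proof. by apply/seteqP; split=> W [BW bb']; split=> //; rewrite bb'. Qed.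

(** A trace that separated every pair of base vectors would make [T] adapted to [B]. *)
Lemma trace_sub T : ~ apt B T ->
  exists b b', [/\ B b, B b', b <> b' & trace (apt B) T `<=` unsep b b'].
Proof.
move=> BT; apply: contrapT => h; apply: BT.
pose F := [set gr_cs W | W in trace (apt B) T].
apply: (separated_adapted (dotn := dotn) Bb (F := F)).
  by move=> _ [Y [_ YT] <-]; apply/(compatibleP dotn).
move=> b b' Bb1 Bb2 bb'; apply: contrapT => hW; apply: h.
exists b, b'; split=> // W BW; split; first by case: BW.
have FW : F W by exists W.
have [BWb BWb'] : (W b \/ perp W b) /\ (W b' \/ perp W b').
  by case: BW => BW _; split; apply: BW.
split=> ?.
  by case: BWb' => // ?; exfalso; apply: hW; exists W => //; left.
by case: BWb => // ?; exfalso; apply: hW; exists W => //; right.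
Qed.

(** [T] arises from some [W0] containing [b] and orthogonal to [b'] by replacing [b] with [b + b'].
    A [W] that separates the pair projects [b + b'] to [b] or [b'], neither of which is in [T]; any
    other [W] of the apartment fixes or kills it. *)
Lemma unsep_trace b b' : B b -> B b' -> b <> b' ->
  exists2 T, ~ apt B T & trace (apt B) T = unsep b b'.
Proof.
move=> Bb1 Bb2 bb'; have [W0 [BW0 W0b W0b']] := apt_separates Bb1 Bb2 bb'.
have b0 := base_neq0 Bb Bb1; have b'0 := base_neq0 Bb Bb2.
have ob : dot b b' = 0 by case: Bb => _ + _; apply.
have ob' := dot_sym0 ob.
pose M := addv (del W0 b) (b + b').
have dM : odim dotn k M.
  rewrite /M; have := gr_odim dotn W0.
  case: (k) k0 W0 W0b W0b' {BW0 M} => // n _ W0 W0b W0b' dW.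
  apply: odimS; first exact: odim_del.
    apply: contraNneq b0 => bb0; apply/eqP/(dot_eq0 (dot := dot)).
    by rewrite -[dot b b]addr0 -ob' -dotDl bb0 dot0l.
  move=> y /(delE dotn)[W0y yb].
  by rewrite dotDl (dot_sym0 yb) W0b'// addr0.
have [T TM] := mk_gr dM.
have Mbb : M (b + b') by apply: addv_mem.
have Mb : ~ M b.
  move=> /(addvE dotn)[y [c [/(delE dotn)[W0y yb] bE]]].
  have c0 : c = 0.
    move: ob; rewrite bE dotDl dotZl dotDl (dot_sym0 (W0b' _ W0y)).
    have -> : dot b b' = 0 by case: Bb => _ + _; apply.
    rewrite !add0r => /eqP; rewrite mulf_eq0 (negbTE (dot_neq0 _ b'0)) orbF.
    by move/eqP.
  by case/eqP: (dot_neq0 dot b0); rewrite {1}bE c0 scale0r addr0.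
exists T.
  move=> BT; case: (BT b Bb1); rewrite TM // => /(_ _ Mbb).
  by rewrite dotDr ob addr0; apply/eqP/dot_neq0.
apply/seteqP; split=> W [BW].
  move=> /compatible_sym/(compatibleP dotn); rewrite TM => MW; split=> //.
  have [Wb|Wb] := BW b Bb1; have [Wb'|Wb'] := BW b' Bb2; split=> // h; exfalso.
  - apply: Mb; rewrite -[b]addr0 -(proj_eq0 dotn Wb') -{1}(proj_id dotn Wb) -projD.
    exact: MW.
  - apply: Mb; rewrite -[b](addrK b'); apply: csB => //.
    rewrite -[b']add0r -(proj_eq0 dotn Wb) -(proj_id dotn Wb') -projD.
    exact: MW.
  - exact: (mem_perp Bb1 h).
  - exact: (mem_perp Bb2 h).
move=> bW; split=> //; apply/compatible_sym/(compatibleP dotn); rewrite TM.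
have Wbb : proj W (b + b') = b + b' \/ proj W (b + b') = 0.
  rewrite projD; have [Wb|Wb] := BW b Bb1.
    by left; rewrite !proj_id//; apply/bW.
  right; have [Wb'|Wb'] := BW b' Bb2; last by rewrite !proj_eq0// addr0.
  by case: (mem_perp Bb1 _ Wb); apply/bW.
move=> _ /(addvE dotn)[y [c [Wy ->]]]; rewrite projD projZ; apply: csD.
  apply: addv_sub; move: y Wy; apply: (adapted_stable dotn Bb) => //.
  exact: adapted_del.
by apply: csZ; case: Wbb => ->; [|apply: cs_zero].
Qed.

(** Otherwise a member of the apartment through [c] and orthogonal to [b], [b'] and [c'] separates
    [c] from [c'] but not [b] from [b']. *)
Lemma unsep_inj b b' c c' : B b -> B b' -> B c -> B c' -> c <> c' ->
  unsep b b' `<=` unsep c c' -> c = b \/ c = b'.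
Proof.
move=> Bb1 Bb2 Bc1 Bc2 cc' sub; apply: contrapT => /not_orP[cb cb'].
pose S := addv (addv (addv (cs0 dotn) b) b') c'.
have Bo x y : B x -> B y -> x <> y -> dot x y = 0 by case: Bb => _ + _; apply.
have [|||X [BX Xc XS]] := @apt_through S c Bc1.
- by do 3!apply: fd_addv; exists 0%N.
- by do 3!apply: adapted_addv => //; apply: adapted0.
- do 3!(apply: perp_addv; last exact: Bo).
  by move=> y /(cs0E dotn) ->; rewrite dot0r.
have nX x : B x -> S x -> ~ X x.
  by move=> Bx Sx Xx; apply: (mem_perp Bx Xx) => y Xy; apply/dot_sym0/XS.
have [_ /proj1] : unsep c c' X.
  apply: sub; split=> //; split=> h; exfalso; move: h; apply: nX => //.
    by do 2!apply: addv_sub; apply: addv_mem.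
  by apply: addv_sub; apply: addv_mem.
by move=> /(_ Xc); apply: nX => //; apply: addv_mem.
Qed.

(** No base is mentioned, so a bijection preserving compatibility carries maximal traces to maximal
    traces. *)
Definition max_trace A F : Prop := exists T, [/\ ~ A T, F = trace A T &
  forall T', ~ A T' -> F `<=` trace A T' -> trace A T' `<=` F].

(** The trace of any [T] outside the apartment lies in some [unsep c c'], and by [unsep_inj] an
    inclusion between two such sets forces the same unordered pair. *)
Lemma max_traceP F : max_trace (apt B) F <->
  exists b b', [/\ B b, B b', b <> b' & F = unsep b b'].
Proof.
split=> [[T [BT -> Tmax]]|[b [b' [Bb1 Bb2 bb' ->]]]].
  have [b [b' [Bb1 Bb2 bb' sub]]] := trace_sub BT.
  have [T' BT' T'E] := unsep_trace Bb1 Bb2 bb'.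
  exists b, b'; split=> //; apply/seteqP; split=> //.
  by rewrite -T'E; apply: Tmax => //; rewrite T'E.
have [T BT TE] := unsep_trace Bb1 Bb2 bb'; exists T; split=> // T' BT' sub.
have [c [c' [Bc1 Bc2 cc' sub']]] := trace_sub BT'.
have sub2 := subset_trans sub sub'; apply: subset_trans sub' _.
have sub3 := sub2; rewrite [X in _ `<=` X]unsepC in sub3.
have [cb|cb] := unsep_inj Bb1 Bb2 Bc1 Bc2 cc' sub2;
have [c'b|c'b] := unsep_inj Bb1 Bb2 Bc2 Bc1 (nesym cc') sub3.
- by case: cc'; rewrite cb c'b.
- by rewrite cb c'b.
- by rewrite cb c'b unsepC.
- by case: cc'; rewrite cb c'b.
Qed.

Lemma finite_base_mem n M : odim dotn n M -> finite_set (B `&` M).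
Proof.
elim: n M => [|n IH] M dM.
  apply: (sub_finite_set _ (finite_set1 (0 : H))) => x [_].
  by rewrite dM => /(cs0E dotn).
have [[b [Bb1 Mb]]|h] := pselect (exists b, B b /\ M b); last first.
  by apply: (sub_finite_set _ (finite_set0 H)) => x Bx; apply: h; exists x.
have fd' := IH _ (odim_del dM Mb (base_neq0 Bb Bb1)).
have := finite_setU [set b] (B `&` del M b); rewrite propeqE => -[_ h].
apply: sub_finite_set (h (conj (finite_set1 b) fd')) => x [Bx Mx].
have [->|/eqP xb] := eqVneq x b; [by left|right; split=> //].
by apply/(delE dotn); split=> //; case: Bb => _ + _; apply.
Qed.

Lemma base_infinite : ~ finite_set B.
Proof.
move=> /finite_seqP[s Bs].
have [S fS sS] : exists2 S, fd dotn S & forall x, x \in s -> S x.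
  elim: (s) => [|x t [S fS tS]]; first by exists (cs0 dotn); [exists 0%N|].
  exists (addv S x); first exact: fd_addv.
  move=> y; rewrite inE => /predU1P[->|/tS]; [exact: addv_mem|exact: addv_sub].
by have [b + Sb] := base_notin fS; rewrite Bs => /= /sS.
Qed.

(* Maximal traces missing both X and Y correspond to the pairs of base vectors
   separated by both; an i in both of X and Y gives infinitely many pairs. *)
Lemma orth_finite X Y : apt B X -> apt B Y ->
  orth X Y <-> finite_set [set F | [/\ max_trace (apt B) F, ~ F X & ~ F Y]].
Proof.
move=> BX BY; split=> [XY|fin x y Xx Yy].
  have fX := finite_base_mem (gr_odim dotn X).
  have fY := finite_base_mem (gr_odim dotn Y).
  apply: sub_finite_set (finite_image2 unsep fX fY) => F.
  have disj b : B b -> X b -> Y b -> False.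
    by move=> Bb1 Xb Yb; apply: (mem_perp Bb1 Xb) => z Xz; apply/dot_sym0/XY.
  have sep b b' Z : apt B Z -> ~ unsep b b' Z -> Z b \/ Z b'.
    move=> BZ nZ; apply: contrapT => /not_orP[Zb Zb']; apply: nZ.
    by split=> //; split.
  have nsep b b' Z : apt B Z -> ~ unsep b b' Z -> ~ (Z b /\ Z b').
    by move=> BZ nZ [Zb Zb']; apply: nZ; split.
  move=> [/max_traceP[b [b' [Bb1 Bb2 bb' ->]]] nX nY].
  have [Xb|Xb] := sep _ _ _ BX nX; have [Yb|Yb] := sep _ _ _ BY nY.
  - by case: (disj b).
  - by exists b => //; exists b'.
  - by rewrite unsepC; exists b' => //; exists b.
  - by case: (disj b').
apply: contrapT => xy.
(* [Y] is preserved by [proj X], so [w] lies in both subspaces, and so does any base vector [b] not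
   orthogonal to it. *)
pose w := proj X y.
have Yw : Y w by apply: (adapted_stable dotn Bb).
have Xw : X w by apply: projM.
have [b Bb1 wb] : exists2 b, B b & dot w b <> 0.
  apply: contrapT => h; apply: xy; rewrite -(proj_id dotn Xx) dot_proj -/w.
  rewrite (base_perp0 dotn Bb (x := w)) ?dot0r// => b Bb1.
  by apply: contrapT => wb; apply: h; exists b.
have Xb : X b by case: (BX b Bb1) => // /(_ w Xw)/dot_sym0.
have Yb : Y b by case: (BY b Bb1) => // /(_ w Yw)/dot_sym0.
(* The sets [unsep b j] for [j] in [J] are distinct maximal traces avoiding [X] and [Y]; so [J] is
   finite, and with it all of [B]. *)
pose J := [set j | B j /\ (~ X j /\ ~ Y j)].
have finJ : finite_set J.
  have jb j : J j -> b <> j by move=> [_ [nX _]] bj; apply: nX; rewrite -bj.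
  have inj : {in J &, injective (unsep b)}.
    move=> j j'; rewrite !inE => Jj Jj' E.
    have [Bj _] := Jj; have [Bj' _] := Jj'.
    have [||E'] := @unsep_inj j' b j b Bj' Bb1 Bj Bb1 (nesym (jb _ Jj)) => //.
      by rewrite unsepC -E unsepC; apply: subset_refl.
    by case: (jb _ Jj).
  rewrite -(eq_finite_set (inj_card_eq inj)); apply: sub_finite_set fin.
  move=> _ [j Jj <-]; have [Bj [nX nY]] := Jj; split.
  - by apply/max_traceP; exists b, j; split=> //; apply: jb.
  - by move=> [_ [/(_ Xb)]].
  - by move=> [_ [/(_ Yb)]].
apply: base_infinite.
apply: (@sub_finite_set _ _ ((B `&` X) `|` ((B `&` Y) `|` J))).
  move=> j Bj; have [Xj|Xj] := pselect (X j); first by left.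
  have [Yj|Yj] := pselect (Y j); first by right; left.
  by right; right.
rewrite !finite_setU; split; first exact: finite_base_mem (gr_odim dotn X).
by split=> //; apply: finite_base_mem (gr_odim dotn Y).
Qed.

End Base.

(** * Bijections preserving compatibility *)

Section CompatibilityPreserving.
Variables (f f' : grassmannian H k -> grassmannian H k).
Hypotheses (fK : cancel f f') (f'K : cancel f' f).

Lemma image_inv A : f' @` (f @` A) = A.
Proof.
rewrite image_comp; apply/seteqP; split=> X.
  by move=> [Y AY <-] /=; rewrite fK.
by move=> AX; exists X; rewrite //= fK.
Qed.

Lemma preimage_inv A : f @^-1` A = f' @` A.
Proof.
apply/seteqP; split=> X /=; first by move=> AfX; exists (f X).
by move=> [Y AY <-]; rewrite /= f'K.
Qed.

Hypothesis f_comp : preserves_compatibility dot f.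

Lemma inv_comp : preserves_compatibility dot f'.
Proof. by move=> X Y; rewrite (f_comp (f' X)) !f'K. Qed.

(** The image is pairwise compatible, so it lies in some apartment. Pulled back by [f'], a member of
    that apartment is compatible with all of [apt B], hence belongs to it by [apt_max]. *)
Lemma apartment_image A :
  orthogonal_apartment dot A -> orthogonal_apartment dot (f @` A).
Proof.
move=> /apartmentP[B Bb ->]; apply/apartmentP.
have [|B' Bb' sub] := @gr_common_base (f @` apt B).
  by move=> _ _ [X BX <-] [Y BY <-]; apply/(proj1 (f_comp _ _))/(apt_compatible Bb).
exists B' => //; apply/seteqP; split=> // Y B'Y.
exists (f' Y) => //; apply: (apt_max Bb) => X BX.
apply/(proj2 (f_comp _ _)); rewrite f'K; apply: (apt_compatible Bb') => //.
by apply: sub; exists X.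
Qed.

Lemma trace_image A T : trace (f @` A) (f T) = f @` trace A T.
Proof.
apply/seteqP; split=> [_ [[X AX <-] /(proj2 (f_comp _ _)) XT]|_ [X [AX XT] <-]].
  by exists X.
by split; [exists X|apply/(proj1 (f_comp _ _))].
Qed.

Lemma max_trace_image A F : max_trace A F -> max_trace (f @` A) (f @` F).
Proof.
have fA T : (f @` A) (f T) -> A T by move=> [X AX /(can_inj fK) <-].
move=> [T [AT -> Tmax]]; exists (f T); split.
- by move=> /fA.
- by rewrite trace_image.
- move=> T'; rewrite -[T']f'K => nT'; rewrite trace_image => sub.
  apply: image_subset; apply: Tmax => [AT'|]; first by apply: nT'; exists (f' T').
  by move=> X FX; have [|Y YT' /(can_inj fK) <-] := sub (f X); [exists X|].
Qed.

End CompatibilityPreserving.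

(** Orthogonal subspaces are compatible and share an apartment, whose image is an apartment. The
    criterion of [orth_finite] is expressed by compatibility alone, so it transfers. *)
Lemma compatibility_orth (f f' : grassmannian H k -> grassmannian H k) X Y :
  cancel f f' -> cancel f' f -> preserves_compatibility dot f ->
  orth X Y -> orth (f X) (f Y).
Proof.
move=> fK f'K f_comp XY.
have cXY : compatible X Y.
  apply/(compatibleP dotn) => x Xx; rewrite proj_eq0; first exact: cs_zero.
  exact: perp_orth Xx.
have [B Bb [BX BY]] := gr_common_base2 cXY.
have : orthogonal_apartment dot (apt B) by apply/apartmentP; exists B.
move=> /(apartment_image f'K f_comp)/apartmentP[B' Bb' E].
have B'X : apt B' (f X) by rewrite -E; exists X.
have B'Y : apt B' (f Y) by rewrite -E; exists Y.
apply/(orth_finite Bb' B'X B'Y); move/(orth_finite Bb BX BY): XY.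
move=> /(finite_image (image^~ f)); apply: sub_finite_set => F [mF nX nY].
exists (f' @` F); last exact: image_inv f'K _.
split.
- rewrite -(image_inv fK (apt B)) E; apply: (max_trace_image f'K fK) => //.
  exact: inv_comp f'K f_comp.
- by move=> [Z FZ E']; apply: nX; rewrite -E' f'K.
- by move=> [Z FZ E']; apply: nY; rewrite -E' f'K.
Qed.

(** Two subspaces are compatible exactly when some apartment contains both. *)
Lemma apartments_compatibility (f f' : grassmannian H k -> grassmannian H k) :
  cancel f f' -> cancel f' f ->
  preserves_apartments dot f <-> preserves_compatibility dot f.
Proof.
move=> fK f'K; split=> [[fA f'A] X Y|f_comp]; last first.
  split=> A; first exact: (apartment_image f'K f_comp).
  by rewrite (preimage_inv fK f'K); apply: (apartment_image fK (inv_comp f'K f_comp)).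
have ex_apt (Z Z' : grassmannian H k) : compatible Z Z' ->
    exists A, [/\ orthogonal_apartment dot A, A Z & A Z'].
  move=> /gr_common_base2[B Bb [BZ BZ']]; exists (apt B); split=> //.
  by apply/apartmentP; exists B.
have apt_comp A Z Z' : orthogonal_apartment dot A -> A Z -> A Z' ->
    compatible Z Z'.
  by move=> /apartmentP[B Bb ->]; apply: apt_compatible.
split=> /ex_apt[A [Aapt AX AY]].
  by apply: (apt_comp (f @` A)); [apply: fA|exists X|exists Y].
by apply: (apt_comp (f @^-1` A)) => //; apply: f'A.
Qed.

End Apartments.

(** For [k = 0] the Grassmannian is a single point and every automorphism extends [f], so uniqueness
    calls for [0 < k]. *)
Theorem theorem1 (R : realType) (H : completeNormedModType R[i])
    (dot : {dot H for Num.conj}) (dotn : induces_norm dot)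
    (Hinf : infinite_dimensional H) (k : nat) (k_gt0 : (0 < k)%N)
    (f : grassmannian H k -> grassmannian H k) (f_bij : bijective f) :
  (preserves_apartments dot f <-> preserves_compatibility dot f) /\
  (preserves_apartments dot f ->
   exists! g : closed_subspace H -> closed_subspace H,
     logic_automorphism dotn g /\
     (forall X : grassmannian H k, g X = f X)).
Proof.
have [f' fK f'K] := f_bij.
have apt_comp := apartments_compatibility dotn Hinf k_gt0 fK f'K.
split=> // /apt_comp f_comp.
have f_orth (X Y : grassmannian H k) :
    orthogonal_sets dot X Y <-> orthogonal_sets dot (f X) (f Y).
  split; first exact: (compatibility_orth dotn Hinf k_gt0 fK f'K f_comp).
  move=> /(compatibility_orth dotn Hinf k_gt0 f'K fK (inv_comp f'K f_comp)).
  by rewrite !fK.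
have [g [ag gf]] := orth_extension dotn Hinf k_gt0 fK f'K f_orth.
exists g; split=> // g' [ag' g'f].
by apply: (automorphism_eq Hinf k_gt0 ag ag') => X; rewrite gf g'f.
Qed.
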